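(* Let $(X,\Sigma,\mathfrak m)$ be any $\sigma$-finite measure space. Let $\mathscr M$ be a separable normed $L^0(\mathfrak m)$-module. Then there exists a separable Banach bundle $E$ over $X$ such that $\Gamma(E)\cong\mathscr M$, i.e. $\Gamma(E)$ and $\mathscr M$ are isomorphic as normed $L^0(\mathfrak m)$-modules.
   Context: Measurable spaces $(X,\Sigma)$ are assumed to satisfy $\{x\}\in\Sigma$ for every $x\in X$. $L^0(\mathfrak m)$: the ring of $\mathfrak m$-a.e. equivalence classes of measurable functions $X\to\mathbb R$, with the distance $d_{L^0(\mathfrak m)}(f,g)=\int\min\{|f-g|,1\}\,d\mathfrak m'$, where $\mathfrak m'$ is a fixed probability measure with $\mathfrak m\ll\mathfrak m'\ll\mathfrak m$ (the induced topology does not depend on $\mathfrak m'$). Normed $L^0(\mathfrak m)$-module: a couple $(\mathscr M,|\cdot|)$ where $\mathscr M$ is an algebraic $L^0(\mathfrak m)$-module, the pointwise norm $|\cdot|\colon\mathscr M\to L^0(\mathfrak m)$ satisfies, $\mathfrak m$-a.e., $|v|\ge0$ with equality iff $v=0$, $|v+w|\le|v|+|w|$, $|f\cdot v|=|f||v|$ for all $f\in L^0(\mathfrak m)$, $v,w\in\mathscr M$, and the distance $d_{\mathscr M}(v,w):=d_{L^0(\mathfrak m)}(|v-w|,0)$ is complete. It is separable if $(\mathscr M,d_{\mathscr M})$ is separable. A morphism is an $L^0(\mathfrak m)$-linear map $\Phi$ with $|\Phi(v)|\le|v|$ $\mathfrak m$-a.e.; an isomorphism is an $L^0(\mathfrak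 m)$-linear bijection preserving the pointwise norm. Direct limits $\varinjlim$ of direct systems of normed $L^0$-modules and morphisms (in the usual sense of the universal property in this category) always exist, uniquely up to unique isomorphism. For $A\in\Sigma$, $\mathfrak m_A:=\mathfrak m|_A$. Any normed $L^0(\mathfrak m_A)$-module $\mathscr N$ can be viewed as a normed $L^0(\mathfrak m)$-module $\mathrm{Ext}_A(\mathscr N)$: $f\in L^0(\mathfrak m)$ acts through its restriction to $A$, and the pointwise norm is extended by $0$ outside $A$. (If $\mathfrak m(A)=0$ all these modules are $\{0\}$.) Let $\mathbb N=\{0,1,2,\dots\}$ and $\bar{\mathbb N}=\mathbb N\cup\{\infty\}$. Set $\mathbb V_n:=\mathbb R^n$ for $n<\infty$ and $\mathbb V_\infty:=c_{00}$, the space of real sequences with finitely many nonzero terms, with the topology of the $\ell^\infty$-norm; $\mathbb V_n$ is identified with the span of the first $n$ canonical vectors $e_1,\dots,e_n$ of $\mathbb V_\infty$. A Banach bundle of dimension $n\in\bar{\mathbb N}$ over $A\in\Sigma$ is a couple $(A,\mathsf n)$ where $\mathsf n\colon A\times\mathbb V_n\to[0,+\infty)$ is measurable (with respect to the product of $\Sigma|_A$ and the Borel $\sigma$-algebra of $\mathbb V_n$) and $\mathsf n(x,\cdot)$ is a norm on $\mathbb V_n$ for every $x\in A$. Sections, finite dimension: for $E=(A,\mathsf n)$ of dimension $n<\infty$, $\Gamma_A(E)$ is the space of measurable maps $s\colon A\to\mathbb R^n$ modulo $\mathfrak m_A$-a.e. equality, a normed $L^0(\mathfrak m_A)$-module with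 pointwise norm $|s|(x)=\mathsf n(x,s(x))$. Any dimension: for $E=(A,\mathsf n)$ of dimension $n\in\bar{\mathbb N}$, let $E_k:=(A,\mathsf n|_{A\times\mathbb V_k})$ for $k\in\mathbb N$, $k\le n$, and let $\iota_{jk}\colon\Gamma_A(E_j)\hookrightarrow\Gamma_A(E_k)$, $j\le k$, be the canonical inclusions $(s_1,\dots,s_j)\mapsto(s_1,\dots,s_j,0,\dots,0)$; then $\Gamma_A(E):=\varinjlim\Gamma_A(E_k)$ in the category of normed $L^0(\mathfrak m_A)$-modules (consistent with the previous definition if $n<\infty$). A separable Banach bundle over $X$ is a family $E=\{(A_n,E_n)\}_{n\in\bar{\mathbb N}}$ where $\{A_n\}_{n\in\bar{\mathbb N}}\subseteq\Sigma$ is a partition of $X$ (into possibly empty sets) and each $E_n=(A_n,\mathsf n_n)$ is a Banach bundle of dimension $n$ over $A_n$. Its space of sections is $\Gamma(E):=\prod_{n\in\bar{\mathbb N}}\mathrm{Ext}_{A_n}(\Gamma_{A_n}(E_n))$ with pointwise norm $|s|:=\sum_{n\in\bar{\mathbb N}}[\chi_{A_n}]_{\mathfrak m}|s_n|$ for $s=\{s_n\}_n$, where $[\chi_{A_n}]_{\mathfrak m}$ is the class of the characteristic function; it is a normed $L^0(\mathfrak m)$-module. *)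

(* Defs.v *)
From HB Require Import structures.
From mathcomp Require Import all_boot all_order all_algebra.
From mathcomp Require Import all_classical all_reals all_analysis.
From mathcomp Require Import measurable_realfun.

Set Implicit Arguments.
Unset Strict Implicit.
Unset Printing Implicit Defensive.

Import Order.TTheory GRing.Theory Num.Theory.
Import numFieldNormedType.Exports.

Local Open Scope classical_set_scope.
Local Open Scope ring_scope.
Local Open Scope quotient_scope.

Section ae_classes.
Context d d' (X : measurableType d) (W : measurableType d') (R : realType).
Variable mu : {measure set X -> \bar R}.

Definition ae_class (f : X -> W) (mf : measurable_fun setT f) :
    {mfun_ mu, X >-> W} :=
  \pi_({mfun_ mu, X >-> W})
    (HB.pack f (isMeasurableFun.Build _ _ _ _ f mf) : {mfun X >-> W}).

Lemma ae_class_repr (f : X -> W) (mf : measurable_fun setT f) :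
  \forall x \ae mu, ae_class mf x = f x.
Proof.
rewrite /ae_class; set g := (X in \pi X).
have : repr (\pi_({mfun_ mu, X >-> W}) g) = g %[mod {mfun_ mu, X >-> W}].
  by rewrite reprK.
move/eqmodP => /asboolP; apply: filterS => x; exact.
Qed.

Lemma ae_classP (f g : {mfun_ mu, X >-> W}) :
  (\forall x \ae mu, f x = g x) -> f = g.
Proof.
move=> fg; rewrite -[f]reprK -[g]reprK; apply/eqmodP/asboolP.
by apply: filterS fg => x + _.
Qed.

Lemma ae_class_measurable (f : {mfun_ mu, X >-> W}) : measurable_fun setT f.
Proof. exact: measurable_funPT. Qed.

End ae_classes.
Arguments ae_class {d d' X W R} mu {f} mf.

(* L^0(mu). Applying f : L0 mu to a point evaluates an arbitrary representative,
   so pointwise statements are meaningful only mu-almost everywhere. *)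
Section L0.
Context d (X : measurableType d) (R : realType).

Definition L0 (mu : {measure set X -> \bar R}) : Type := {mfun_ mu, X >-> R}.

Variable mu : {measure set X -> \bar R}.
Implicit Types f g h : L0 mu.

HB.instance Definition _ := Choice.on (L0 mu).
Definition L0_fun (f : L0 mu) : X -> R := aqEqMfun_to_fun f.
Coercion L0_fun : L0 >-> Funclass.

Let mf f : measurable_fun setT f := ae_class_measurable f.

Definition L0_zero : L0 mu := ae_class mu (measurable_cst (0 : R)).
Definition L0_one : L0 mu := ae_class mu (measurable_cst (1 : R)).
Definition L0_opp f : L0 mu := ae_class mu (measurable_funN (mf f)).
Definition L0_add f g : L0 mu := ae_class mu (measurable_funD (mf f) (mf g)).
Definition L0_mul f g : L0 mu := ae_class mu (measurable_funM (mf f) (mf g)).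
Definition L0_abs f : L0 mu :=
  ae_class mu (measurableT_comp (@normr_measurable R setT) (mf f)).

Let zeroE : \forall x \ae mu, L0_zero x = 0.
Proof. exact: ae_class_repr. Qed.
Let oneE : \forall x \ae mu, L0_one x = 1.
Proof. exact: ae_class_repr. Qed.
Let oppE f : \forall x \ae mu, L0_opp f x = - f x.
Proof. exact: ae_class_repr. Qed.
Let addE f g : \forall x \ae mu, L0_add f g x = f x + g x.
Proof. exact: ae_class_repr. Qed.
Let mulE f g : \forall x \ae mu, L0_mul f g x = f x * g x.
Proof. exact: ae_class_repr. Qed.
Lemma L0_absE f : \forall x \ae mu, L0_abs f x = `|f x|.
Proof. exact: ae_class_repr. Qed.

Lemma L0P f g : (\forall x \ae mu, f x = g x) -> f = g.
Proof. exact: ae_classP. Qed.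

Let addA : associative L0_add.
Proof.
move=> f g h; apply: L0P; near=> x.
rewrite (near (addE f (L0_add g h)) x)// (near (addE g h) x)//.
by rewrite (near (addE (L0_add f g) h) x)// (near (addE f g) x)// addrA.
Unshelve. all: by end_near. Qed.

Let addC : commutative L0_add.
Proof.
move=> f g; apply: L0P; near=> x.
by rewrite (near (addE f g) x)// (near (addE g f) x)// addrC.
Unshelve. all: by end_near. Qed.

Let add0 : left_id L0_zero L0_add.
Proof.
move=> f; apply: L0P; near=> x.
by rewrite (near (addE L0_zero f) x)// (near zeroE x)// add0r.
Unshelve. all: by end_near. Qed.

Let addN : left_inverse L0_zero L0_opp L0_add.
Proof.
move=> f; apply: L0P; near=> x.
rewrite (near (addE (L0_opp f) f) x)// (near zeroE x)//.
by rewrite (near (oppE f) x)// addNr.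
Unshelve. all: by end_near. Qed.

HB.instance Definition _ := GRing.isZmodule.Build (L0 mu) addA addC add0 addN.

Let mulA : associative L0_mul.
Proof.
move=> f g h; apply: L0P; near=> x.
rewrite (near (mulE f (L0_mul g h)) x)// (near (mulE g h) x)//.
by rewrite (near (mulE (L0_mul f g) h) x)// (near (mulE f g) x)// mulrA.
Unshelve. all: by end_near. Qed.

Let mulC : commutative L0_mul.
Proof.
move=> f g; apply: L0P; near=> x.
by rewrite (near (mulE f g) x)// (near (mulE g f) x)// mulrC.
Unshelve. all: by end_near. Qed.

Let mul1 : left_id L0_one L0_mul.
Proof.
move=> f; apply: L0P; near=> x.
by rewrite (near (mulE L0_one f) x)// (near oneE x)// mul1r.
Unshelve. all: by end_near. Qed.

Let mulDl : left_distributive L0_mul +%R.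
Proof.
move=> f g h; apply: L0P; near=> x.
rewrite (near (mulE (L0_add f g) h) x)// (near (addE f g) x)//.
rewrite (near (addE (L0_mul f h) (L0_mul g h)) x)//.
by rewrite (near (mulE f h) x)// (near (mulE g h) x)// mulrDl.
Unshelve. all: by end_near. Qed.

HB.instance Definition _ :=
  GRing.Zmodule_isComPzRing.Build (L0 mu) mulA mulC mul1 mulDl.

Lemma L0_0E : \forall x \ae mu, (0 : L0 mu) x = 0.
Proof. exact: zeroE. Qed.
Lemma L0_1E : \forall x \ae mu, (1 : L0 mu) x = 1.
Proof. exact: oneE. Qed.
Lemma L0_NE f : \forall x \ae mu, (- f : L0 mu) x = - f x.
Proof. exact: oppE. Qed.
Lemma L0_DE f g : \forall x \ae mu, (f + g : L0 mu) x = f x + g x.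
Proof. exact: addE. Qed.
Lemma L0_ME f g : \forall x \ae mu, (f * g : L0 mu) x = f x * g x.
Proof. exact: mulE. Qed.

End L0.

Section normed_modules.
Context d (X : measurableType d) (R : realType).

(* The metric of L^0(mu), for a probability measure P having the same null sets
   as mu; it does not depend on the representatives of f and g. *)
Definition L0_dist (mu : {measure set X -> \bar R}) (P : probability X R)
  (f g : L0 mu) : R := (\int[P]_x Num.min `|f x - g x| 1)%R.

(* A normed L^0(mu)-module, except for completeness. *)
Record premodule (mu : {measure set X -> \bar R}) := Premodule {
  pcarrier :> lmodType (L0 mu) ;
  pnorm : pcarrier -> L0 mu ;
  pnorm_ge0 : forall v, \forall x \ae mu, 0 <= pnorm v x ;
  pnorm_eq0 : forall v, pnorm v = 0 <-> v = 0 ;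
  ler_pnormD : forall v w,
    \forall x \ae mu, pnorm (v + w) x <= pnorm v x + pnorm w x ;
  pnormZ : forall f v, pnorm (f *: v) = L0_abs f * pnorm v }.

Variable mu : {measure set X -> \bar R}.

Definition pdist (P : probability X R) (M : premodule mu) (v w : M) : R :=
  L0_dist P (pnorm (v - w)) 0.
(* The Cauchy and the convergent sequences do not depend on the choice of P, so
   completeness is required for every admissible P. There is an admissible P as
   soon as mu is sigma-finite and nonzero; if mu = 0 there is none, but then
   L^0(mu), hence M, is {0} and M is indeed complete. *)
Definition pcomplete (M : premodule mu) :=
  forall P : probability X R, mu `<< P -> P `<< mu ->
  forall u : nat -> M,
    (forall e, 0 < e -> exists N, forall i j, (N <= i)%N -> (N <= j)%N ->
       pdist P (u i) (u j) < e) ->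
    exists v, (fun i => pdist P (u i) v) @ \oo --> 0.
Record normed_module := NormedModule {
  nm_pre :> premodule mu ;
  nm_complete : pcomplete nm_pre }.
End normed_modules.

Section c00.
Variable R : realType.

(* Finitely supported real sequences, normed by v |-> sup_i |v_i|. *)
Definition c00_pred : {pred nat -> R} :=
  fun v => `[< exists k, forall i, (k <= i)%N -> v i = 0 >].

Let c00_submod : submod_closed c00_pred.
Proof.
split; first by apply/asboolP; exists 0%N.
move=> a u v /asboolP[k uk] /asboolP[l vl]; apply/asboolP.
exists (maxn k l) => i; rewrite geq_max => /andP[ki li].
by rewrite -[LHS]/(a *: u i + v i) uk// vl// scaler0 addr0.
Qed.

HB.instance Definition _ := GRing.isSubmodClosed.Build R (nat -> R) c00_pred
  c00_submod.

Record c00 := C00 { c00_val :> nat -> R ; c00P : c00_val \in c00_pred }.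

HB.instance Definition _ := [isSub for c00_val].
HB.instance Definition _ := [Choice of c00 by <:].
HB.instance Definition _ := [SubChoice_isSubLmodule of c00 by <:].

Definition c00_norm (v : c00) : R := sup (range (fun i => `|v i|)).

Lemma c00_has_sup (v : c00) : has_sup (range (fun i => `|v i|)).
Proof.
split; first by exists `|v 0%N|, 0%N.
have /asboolP[k vk] := c00P v.
exists (\sum_(i < k) `|v i|) => _ [i _ <-].
have [ik|/vk->] := ltnP i k; last by rewrite normr0 sumr_ge0.
by rewrite (bigD1 (Ordinal ik))//= lerDl sumr_ge0.
Qed.

Lemma ler_c00_norm (v : c00) i : `|v i| <= c00_norm v.
Proof. by apply: (sup_upper_bound (c00_has_sup v)); exists i. Qed.

Lemma c00_norm_le (v : c00) e : (forall i, `|v i| <= e) -> c00_norm v <= e.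
Proof.
move=> ve; apply: ge_sup; first exact: (c00_has_sup v).1.
by move=> _ [i _ <-].
Qed.

Let c00_normD u v : c00_norm (u + v) <= c00_norm u + c00_norm v.
Proof.
apply: c00_norm_le => i; apply: le_trans (ler_normD _ _) _.
by apply: lerD; exact: ler_c00_norm.
Qed.

Let c00_normZ (a : R) u : c00_norm (a *: u) = `|a| * c00_norm u.
Proof.
have le b w : c00_norm (b *: w) <= `|b| * c00_norm w.
  apply: c00_norm_le => i; rewrite -[X in `|X|]/(b * w i) normrM.
  by rewrite ler_wpM2l// ler_c00_norm.
have [->|a0] := eqVneq a 0.
  rewrite scale0r normr0 mul0r; apply/eqP; rewrite eq_le.
  rewrite c00_norm_le => [|i]; last by rewrite normr0.
  exact: le_trans (normr_ge0 _) (ler_c00_norm 0 0).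
apply/eqP; rewrite eq_le le/= -ler_pdivlMl ?normr_gt0//.
by rewrite -normfV -[in leLHS](scalerK a0 u).
Qed.

Let c00_norm0_eq0 u : c00_norm u = 0 -> u = 0.
Proof.
move=> u0; apply/val_inj/funext => i; apply/eqP.
by rewrite -normr_le0 -u0 ler_c00_norm.
Qed.

HB.instance Definition _ :=
  Lmodule_isNormed.Build R c00 c00_normD c00_normZ c00_norm0_eq0.

End c00.
Arguments c00_pred {R}.

Section fibre_spaces.
Variable R : realType.

(* Dimensions are elements of option nat, None standing for infinity. The
   library norm on 'rV[R]_k is the max norm. *)
Definition Vspace (n : option nat) : normedModType R :=
  match n with
  | Some k => 'rV[R]_k
  | None => c00 R
  end.

(* V with its Borel sigma-algebra *)
Definition borel (V : normedModType R) := g_sigma_algebraType (@open V).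

Definition dim_le (k : nat) (n : option nat) : bool :=
  if n is Some m then (k <= m)%N else true.

Definition coord k (v : 'rV[R]_k) (i : nat) : R :=
  if insub i is Some j then v 0 j else 0.

Lemma coord_c00 k (v : 'rV[R]_k) : coord v \in c00_pred.
Proof.
by apply/asboolP; exists k => i ki; rewrite /coord insubN// -leqNgt.
Qed.

(* R^k as the span of the first k canonical vectors of Vspace n (padding with
   zeros). Only used for k <= n: otherwise it truncates. *)
Definition emb k n : 'rV[R]_k -> Vspace n :=
  match n with
  | Some m => fun v => \row_(i < m) coord v i
  | None => fun v => C00 (coord_c00 v)
  end.

Lemma coordP k (v : 'rV[R]_k) (j : 'I_k) : coord v j = v 0 j.
Proof. by rewrite /coord valK. Qed.

Lemma coord_linear k i : linear (fun v : 'rV[R]_k => coord v i).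
Proof.
move=> a u v; rewrite /coord; case: insubP => [j _ _|_].
  by rewrite !mxE.
by rewrite scaler0 addr0.
Qed.

Lemma emb_linear k n : linear (@emb k n).
Proof.
move=> a u v; case: n => [m|] /=.
  by apply/rowP => i; rewrite !mxE coord_linear.
by apply/val_inj/funext => i; exact: coord_linear.
Qed.

Lemma emb_inj k n : dim_le k n -> injective (@emb k n).
Proof.
move=> kn u v uv; apply/rowP => j; rewrite -!coordP.
case: n kn uv => [m|] /= kn.
  by move=> /rowP/(_ (widen_ord kn j)); rewrite !mxE.
by move=> /(congr1 (@c00_val R))/(congr1 (@^~ (j : nat))).
Qed.

Lemma coord_le k (v : 'rV[R]_k) i : `|coord v i| <= `|v|.
Proof.
rewrite /coord; case: insubP => [j _ _|_]; last by rewrite normr0.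
rewrite [leRHS]/Num.norm/= mx_normrE.
by apply/bigmax_geP; right => /=; exists (0, j).
Qed.

Lemma emb_norm_le k n (v : 'rV[R]_k) : `|@emb k n v| <= `|v|.
Proof.
case: n => [m|] /=.
  rewrite [leLHS]/Num.norm/= mx_normrE; apply/bigmax_leP; split => //= i _.
  by rewrite mxE coord_le.
by apply: c00_norm_le => i; exact: coord_le.
Qed.

Lemma short_linear_continuous (V W : normedModType R) (f : V -> W) :
  linear f -> (forall v, `|f v| <= `|v|) -> continuous f.
Proof.
move=> lf fle v; apply/cvgrPdist_lt => e e0; near=> w.
have -> : f v - f w = f (v - w).
  have := lf (-1) w v.
  by rewrite !scaleN1r [- w + v]addrC [- f w + f v]addrC => ->.
apply: le_lt_trans (fle _) _.
by near: w; exact: cvgr_dist_lt.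
Unshelve. all: by end_near. Qed.

Lemma emb_continuous k n :
  continuous (@emb k n : ('rV[R]_k : normedModType R) -> Vspace n).
Proof.
by apply: short_linear_continuous; [exact: emb_linear|exact: emb_norm_le].
Qed.

Definition has_dense_seq (V : normedModType R) :=
  exists (I : countType) (a : I -> V), forall v e, 0 < e ->
    exists i, `|v - a i| < e.

Lemma ratr_dense (v e : R) : 0 < e -> exists q : rat, `|v - ratr q| < e.
Proof.
move=> e0; have : v < v + e by rewrite ltrDl.
move=> /rat_in_itvoo[q]; rewrite in_itv/= => /andP[vq qv]; exists q.
by rewrite distrC gtr0_norm ?subr_gt0// ltrBlDl.
Qed.

Lemma R_dense : has_dense_seq R.
Proof. by exists rat, ratr; exact: ratr_dense. Qed.

Lemma Vspace_dense n : has_dense_seq (Vspace n).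
Proof.
case: n => [k|] /=.
  exists 'rV[rat]_k, (map_mx ratr) => v e e0.
  have /choice[q qP] j : exists q : rat, `|v 0 j - ratr q| < e.
    exact: ratr_dense.
  exists (\row_j q j); rewrite [ltLHS]/Num.norm/= mx_normrE.
  apply/bigmax_ltP; split => //= -[i j] _ /=.
  by rewrite !mxE ord1.
exists (seq rat), (fun s => C00 (coord_c00 (\row_(i < size s) ratr s`_i))).
move=> v e e0.
have e20 : 0 < e / 2 by rewrite divr_gt0.
have /choice[q qP] j : exists q : rat, `|v j - ratr q| < e / 2.
  exact: ratr_dense.
have /asboolP[k vk] := c00P v.
exists (mkseq q k); apply: (@le_lt_trans _ _ (e / 2)); last first.
  by rewrite ltr_pdivrMr// mulr_natr mulr2n ltrDl.
apply: c00_norm_le => i.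
rewrite -[X in `|X|]/(v i - coord _ i) /coord.
case: insubP => [j jk ji|]; last first.
  rewrite size_mkseq -leqNgt => ik.
  by rewrite vk// subr0 normr0 ltW.
rewrite mxE ji nth_mkseq; first exact/ltW/qP.
by rewrite size_mkseq in jk.
Qed.

End fibre_spaces.

Section borel_maps.
Context d (X : measurableType d) (R : realType).

Lemma borel_open (V : normedModType R) (f : X -> borel V) :
  measurable_fun setT f <->
  forall U : set V, open U -> measurable (f @^-1` U).
Proof.
split=> [mf U oU|mf].
  by rewrite -[f @^-1` U]setTI; apply: mf => //; exact: sub_sigma_algebra.
apply: (@measurability _ _ _ (borel V) setT f (@open V)) => //.
by move=> _ [U oU <-]; rewrite setTI; exact: mf.
Qed.

Lemma borel_comp2 (V1 V2 W : normedModType R) (f : X -> V1) (g : X -> V2)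
    (F : V1 * V2 -> W) :
  has_dense_seq V1 -> has_dense_seq V2 ->
  (forall U, open U -> measurable (f @^-1` U)) ->
  (forall U, open U -> measurable (g @^-1` U)) ->
  continuous F -> measurable_fun setT (fun x => F (f x, g x) : borel W).
Proof.
move=> [I [a aP]] [J [b bP]] mf mg cF; apply/borel_open => U oU.
pose r (n : nat) : R := n.+1%:R^-1.
pose G (p : I * J * nat) : set X :=
  [set x | ball (a p.1.1) (r p.2) `*` ball (b p.1.2) (r p.2)
     `<=` F @^-1` U /\
     (f @^-1` ball (a p.1.1) (r p.2) `&` g @^-1` ball (b p.1.2) (r p.2)) x].
have -> : (fun x => F (f x, g x) : borel W) @^-1` U = \bigcup_p G p.
  apply/seteqP; split => [x /= Ux|x [[[i j] n] _] /= [sU [fx gx]]]; last first.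
    exact: (sU (_, _)).
  have : nbhs (f x, g x) (F @^-1` U) by apply: cF; exact: open_nbhs_nbhs.
  move=> /nbhs_ballP[e /= e0 eU].
  have e20 : 0 < e / 2 by rewrite divr_gt0.
  have [n ne] : exists n, r n < e / 2.
    by have [n _ /(_ _ (leqnn n))] := near_infty_natSinv_lt (PosNum e20); exists n.
  have rn0 : 0 < r n by rewrite /r invr_gt0.
  have [i fi] := aP (f x) _ rn0; have [j gj] := bP (g x) _ rn0.
  exists (i, j, n) => //; split => /=; last first.
    by split; rewrite -ball_normE /= distrC.
  move=> [y z] /= [yi zj]; apply: eU; split => /=.
    apply: (@le_ball _ _ _ (r n + r n)).
      by rewrite [leRHS]splitr lerD// ltW.
    by apply: ball_triangle yi; rewrite -ball_normE.
  apply: (@le_ball _ _ _ (r n + r n)).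
    by rewrite [leRHS]splitr lerD// ltW.
  by apply: ball_triangle zj; rewrite -ball_normE.
apply: countable_bigcupT_measurable => [|[[i j] n]].
  exact: countableP.
rewrite /G /=.
have [sU|nsU] := pselect (ball (a i) (r n) `*` ball (b j) (r n) `<=` F @^-1` U).
  rewrite (_ : [set _ | _] =
      f @^-1` ball (a i) (r n) `&` g @^-1` ball (b j) (r n)).
    by apply: measurableI; [apply: mf|apply: mg]; exact: ball_open.
  by apply/seteqP; split => x /=; tauto.
rewrite (_ : [set _ | _] = set0) //.
by apply/seteqP; split => x /=; tauto.
Qed.

End borel_maps.

Section sections.
Context d (X : measurableType d) (R : realType).

(* mu-a.e. classes of measurable maps X -> R^k, an L^0(mu)-module under the
   pointwise operations *)
Definition vsections (mu : {measure set X -> \bar R}) (k : nat) : Type :=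
  {mfun_ mu, X >-> borel 'rV[R]_k}.

Variables (mu : {measure set X -> \bar R}) (k : nat).
Implicit Types (f g : L0 mu) (s t u : vsections mu k).

HB.instance Definition _ := Choice.on (vsections mu k).
Definition vsections_fun s : X -> 'rV[R]_k := aqEqMfun_to_fun s.
Coercion vsections_fun : vsections >-> Funclass.

Lemma vsectionsP s t : (\forall x \ae mu, s x = t x) -> s = t.
Proof. exact: (@ae_classP _ _ X (borel 'rV[R]_k) R mu s t). Qed.

Let ms s : measurable_fun setT (s : X -> borel 'rV[R]_k) :=
  ae_class_measurable s.

Let ms_open s U : open U -> measurable (s @^-1` U).
Proof. by apply: (borel_open _).1; exact: ms. Qed.

Let mL0_open f U : open U -> measurable (f @^-1` U).
Proof.
move=> oU; rewrite -[_ @^-1` _]setTI.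
by apply: (ae_class_measurable f) => //; exact: open_measurable.
Qed.

Let m0 : measurable_fun setT (fun _ : X => 0 : borel 'rV[R]_k).
Proof. exact: measurable_cst. Qed.

Let mD s t : measurable_fun setT (fun x => s x + t x : borel 'rV[R]_k).
Proof.
by apply: (@borel_comp2 _ _ _ _ _ _ _ _ (fun z => z.1 + z.2));
  [exact: (Vspace_dense R (Some k))|exact: (Vspace_dense R (Some k))
  |exact: ms_open|exact: ms_open|exact: add_continuous].
Qed.

Let mZ f s : measurable_fun setT (fun x => f x *: s x : borel 'rV[R]_k).
Proof.
by apply: (@borel_comp2 _ _ _ R^o _ _ _ _ (fun z => z.1 *: z.2));
  [exact: R_dense|exact: (Vspace_dense R (Some k))
  |exact: mL0_open|exact: ms_open|exact: scale_continuous].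
Qed.

Definition vs_zero : vsections mu k := ae_class mu m0.
Definition vs_add s t : vsections mu k := ae_class mu (mD s t).
Definition vs_scale f s : vsections mu k := ae_class mu (mZ f s).
Definition vs_opp s : vsections mu k := vs_scale (-1) s.

Let zeroE : \forall x \ae mu, vs_zero x = 0.
Proof. exact: (ae_class_repr mu m0). Qed.
Let addE s t : \forall x \ae mu, vs_add s t x = s x + t x.
Proof. exact: (ae_class_repr mu (mD s t)). Qed.
Let scaleE f s : \forall x \ae mu, vs_scale f s x = f x *: s x.
Proof. exact: (ae_class_repr mu (mZ f s)). Qed.
Let oppE s : \forall x \ae mu, vs_opp s x = - s x.
Proof.
near=> x; rewrite (near (scaleE (-1) s) x)// (near (L0_NE 1) x)//.
by rewrite (near (L0_1E mu) x)// scaleN1r.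
Unshelve. all: by end_near. Qed.

Let addA : associative vs_add.
Proof.
move=> s t u; apply: vsectionsP; near=> x.
rewrite (near (addE s (vs_add t u)) x)// (near (addE t u) x)//.
by rewrite (near (addE (vs_add s t) u) x)// (near (addE s t) x)// addrA.
Unshelve. all: by end_near. Qed.

Let addC : commutative vs_add.
Proof.
move=> s t; apply: vsectionsP; near=> x.
by rewrite (near (addE s t) x)// (near (addE t s) x)// addrC.
Unshelve. all: by end_near. Qed.

Let add0 : left_id vs_zero vs_add.
Proof.
move=> s; apply: vsectionsP; near=> x.
by rewrite (near (addE vs_zero s) x)// (near zeroE x)// add0r.
Unshelve. all: by end_near. Qed.

Let addN : left_inverse vs_zero vs_opp vs_add.
Proof.
move=> s; apply: vsectionsP; near=> x.
rewrite (near (addE (vs_opp s) s) x)// (near zeroE x)//.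
by rewrite (near (oppE s) x)// addNr.
Unshelve. all: by end_near. Qed.

HB.instance Definition _ :=
  GRing.isZmodule.Build (vsections mu k) addA addC add0 addN.

Let scaleA f g s : vs_scale f (vs_scale g s) = vs_scale (f * g) s.
Proof.
apply: vsectionsP; near=> x.
rewrite (near (scaleE f (vs_scale g s)) x)// (near (scaleE g s) x)//.
by rewrite (near (scaleE (f * g) s) x)// (near (L0_ME f g) x)// scalerA.
Unshelve. all: by end_near. Qed.

Let scale1 : left_id 1 vs_scale.
Proof.
move=> s; apply: vsectionsP; near=> x.
by rewrite (near (scaleE 1 s) x)// (near (L0_1E mu) x)// scale1r.
Unshelve. all: by end_near. Qed.

Let scaleDr : right_distributive vs_scale +%R.
Proof.
move=> f s t; apply: vsectionsP; near=> x.
rewrite (near (scaleE f (vs_add s t)) x)// (near (addE s t) x)//.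
rewrite (near (addE (vs_scale f s) (vs_scale f t)) x)//.
by rewrite (near (scaleE f s) x)// (near (scaleE f t) x)// scalerDr.
Unshelve. all: by end_near. Qed.

Let scaleDl s : {morph vs_scale^~ s : f g / f + g >-> f + g}.
Proof.
move=> f g; apply: vsectionsP; near=> x.
rewrite (near (scaleE (f + g) s) x)// (near (L0_DE f g) x)//.
rewrite (near (addE (vs_scale f s) (vs_scale g s)) x)//.
by rewrite (near (scaleE f s) x)// (near (scaleE g s) x)// scalerDl.
Unshelve. all: by end_near. Qed.

HB.instance Definition _ := GRing.Zmodule_isLmodule.Build (L0 mu)
  (vsections mu k) scaleA scale1 scaleDr scaleDl.

Lemma vsections0E : \forall x \ae mu, (0 : vsections mu k) x = 0.
Proof. exact: zeroE. Qed.
Lemma vsectionsDE s t : \forall x \ae mu, (s + t : vsections mu k) x = s x + t x.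
Proof. exact: addE. Qed.
Lemma vsectionsZE f s : \forall x \ae mu, (f *: s : vsections mu k) x = f x *: s x.
Proof. exact: scaleE. Qed.

End sections.

Section banach_bundles.
Context d (X : measurableType d) (R : realType).

Definition is_norm (V : lmodType R) (p : V -> R) : Prop :=
  [/\ forall v, 0 <= p v,
      forall v, p v = 0 -> v = 0,
      forall u v, p (u + v) <= p u + p v &
      forall (a : R) v, p (a *: v) = `|a| * p v].

(* A Banach bundle of dimension n over A. The values of bnorm off A are
   irrelevant, and measurability is that of the restriction to A x V_n. *)
Record banach_bundle (A : set X) (n : option nat) := BanachBundle {
  bnorm : X -> Vspace R n -> R ;
  bnorm_measurable : measurable_fun (A `*` [set: borel (Vspace R n)])
    (fun p : X * borel (Vspace R n) => bnorm p.1 p.2) ;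
  bnorm_norm : forall x, A x -> is_norm (bnorm x) }.

(* E_k, the restriction of E to A x V_k *)
Section sub_bundle.
Variables (A : set X) (mA : measurable A) (n : option nat).
Variables (E : banach_bundle A n) (k : nat) (kn : dim_le k n).

Definition sub_bnorm (x : X) (v : Vspace R (Some k)) : R :=
  bnorm E x (emb n v).

Lemma emb_measurable :
  measurable_fun setT (emb n : borel 'rV[R]_k -> borel (Vspace R n)).
Proof.
apply/borel_open => U oU; apply: sub_sigma_algebra.
by move/continuousP : (@emb_continuous R k n); exact.
Qed.

Lemma sub_bnorm_measurable :
  measurable_fun (A `*` [set: borel (Vspace R (Some k))])
    (fun p : X * borel (Vspace R (Some k)) => sub_bnorm p.1 p.2).
Proof.
apply: (@measurable_comp _ _ _ _ _ _ (A `*` [set: borel (Vspace R n)])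
  (fun p : X * borel (Vspace R n) => bnorm E p.1 p.2)
  _ (fun p : X * borel 'rV[R]_k => (p.1, emb n p.2))).
- exact: measurableX.
- by move=> _ [p [Ap _] <-].
- exact: bnorm_measurable.
- apply: measurable_funTS; apply: measurable_fun_pair => //.
  exact: (measurableT_comp emb_measurable).
Qed.

Lemma sub_bnorm_norm x : A x -> is_norm (sub_bnorm x).
Proof.
move=> /(bnorm_norm E)[p0 p0_eq pD pZ].
have e0 : emb n (0 : 'rV[R]_k) = 0.
  by have := @emb_linear R k n (-1) 0 0; rewrite scaler0 addr0 scaleN1r addNr.
have eZ a v : emb n (a *: v : 'rV[R]_k) = a *: emb n v.
  by rewrite -[_ *: v]addr0 emb_linear e0 addr0.
rewrite /sub_bnorm; split.
- by move=> v; exact: p0.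
- by move=> v /p0_eq; rewrite -e0 => /(emb_inj kn).
- by move=> u v; rewrite -[u in emb n (u + v)]scale1r emb_linear scale1r.
- by move=> a v; rewrite eZ.
Qed.

Definition sub_bundle : banach_bundle A (Some k) :=
  BanachBundle sub_bnorm_measurable sub_bnorm_norm.

End sub_bundle.

(* The sections of a bundle of finite dimension over A. With m_A the measure
   m (_ `&` A) on X, measurable functions on A modulo m_A are identified with
   measurable functions on X modulo m_A: by ae_mrestr, m_A-a.e. means m-a.e. on
   A. In particular L0 (mrestr m mA) is L^0(m_A). *)
Section fin_sections.
Variables (m : {measure set X -> \bar R}) (A : set X) (mA : measurable A).
Variables (k : nat) (E : banach_bundle A (Some k)).

Local Notation mu := (mrestr m mA).

Lemma ae_mrestr (P : set X) :
  (\forall x \ae mu, P x) <-> \forall x \ae m, A x -> P x.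
Proof.
split=> [[N [mN N0 PN]]|[N [mN N0 PN]]].
  exists (N `&` A); split => //; first exact: measurableI.
  by move=> x /= /not_implyP[Ax Px]; split => //; exact: PN.
exists (N `|` ~` A); split.
- by apply: measurableU => //; exact: measurableC.
- rewrite /mrestr setIUl setICl setU0.
  apply: (subset_measure0 _ mN _ N0); first exact: measurableI.
  exact: subIsetl.
- by move=> x /= Px; have [Ax|] := pselect (A x); [left; apply: PN => /= /(_ Ax)|right].
Qed.

Lemma mrestr_in : \forall x \ae mu, A x.
Proof. by apply/ae_mrestr; exact: aeW. Qed.

Lemma fsec_norm_measurable (s : vsections mu k) :
  measurable_fun setT ((fun x => bnorm E x (s x)) \_ A).
Proof.
apply/(measurable_restrictT _ mA).
apply: (@measurable_comp _ _ _ _ _ _ (A `*` [set: borel 'rV[R]_k])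
  (fun p : X * borel 'rV[R]_k => bnorm E p.1 p.2)
  _ (fun x => (x, s x))).
- exact: measurableX.
- by move=> _ [p Ap <-].
- exact: (bnorm_measurable E).
- by apply: measurable_funTS; exact: measurable_fun_pair.
Qed.

Definition fsec_norm (s : vsections mu k) : L0 mu :=
  ae_class mu (fsec_norm_measurable s).

Lemma fsec_normE (s : vsections mu k) :
  \forall x \ae mu, fsec_norm s x = bnorm E x (s x).
Proof.
have nE : \forall x \ae mu,
    fsec_norm s x = ((fun x => bnorm E x (s x)) \_ A) x.
  exact: ae_class_repr.
near=> x; rewrite (near nE x)//.
by rewrite patchE mem_set//; near: x; exact: mrestr_in.
Unshelve. all: by end_near. Qed.

Let fsec_norm_ge0 s : \forall x \ae mu, 0 <= fsec_norm s x.
Proof.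
near=> x; rewrite (near (fsec_normE s) x)//.
have /(bnorm_norm E)[p0 _ _ _] : A x by near: x; exact: mrestr_in.
exact: p0.
Unshelve. all: by end_near. Qed.

Let fsec_norm_eq0 s : fsec_norm s = 0 <-> s = 0.
Proof.
split=> [s0|->].
  apply: vsectionsP; near=> x.
  have /(bnorm_norm E)[_ p0 _ _] : A x by near: x; exact: mrestr_in.
  rewrite (near (vsections0E mu k) x)//; apply: p0.
  by rewrite -(near (fsec_normE s) x)// s0 (near (L0_0E mu) x).
apply: L0P; near=> x.
have /(bnorm_norm E)[_ _ _ pZ] : A x by near: x; exact: mrestr_in.
rewrite (near (fsec_normE 0) x)// (near (L0_0E mu) x)//.
rewrite (near (vsections0E mu k) x)//.
by rewrite -(scale0r (0 : Vspace R (Some k))) pZ normr0 mul0r.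
Unshelve. all: by end_near. Qed.

Let fsec_normD s t :
  \forall x \ae mu, fsec_norm (s + t) x <= fsec_norm s x + fsec_norm t x.
Proof.
near=> x; rewrite (near (fsec_normE s) x)// (near (fsec_normE t) x)//.
rewrite (near (fsec_normE (s + t)) x)// (near (vsectionsDE s t) x)//.
have /(bnorm_norm E)[_ _ pD _] : A x by near: x; exact: mrestr_in.
exact: pD.
Unshelve. all: by end_near. Qed.

Let fsec_normZ f s : fsec_norm (f *: s) = L0_abs f * fsec_norm s.
Proof.
apply: L0P; near=> x.
rewrite (near (fsec_normE (f *: s)) x)// (near (vsectionsZE f s) x)//.
rewrite (near (L0_ME (L0_abs f) (fsec_norm s)) x)// (near (L0_absE f) x)//.
rewrite (near (fsec_normE s) x)//.
have /(bnorm_norm E)[_ _ _ pZ] : A x by near: x; exact: mrestr_in.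
exact: pZ.
Unshelve. all: by end_near. Qed.

Definition fin_sections : premodule mu := @Premodule _ _ _ mu
  (vsections mu k) fsec_norm fsec_norm_ge0 fsec_norm_eq0 fsec_normD fsec_normZ.

End fin_sections.

(* (s_1, ..., s_j) |-> (s_1, ..., s_j, 0, ..., 0) *)
Definition vsections_emb (mu : {measure set X -> \bar R}) (j k : nat)
    (s : vsections mu j) : vsections mu k :=
  ae_class mu (measurableT_comp (@emb_measurable (Some k) j)
    (ae_class_measurable s)).

End banach_bundles.

Section direct_limits.
Context d (X : measurableType d) (R : realType).
Variable mu : {measure set X -> \bar R}.

Definition is_morphism (M N : premodule mu) (Phi : M -> N) : Prop :=
  linear Phi /\ forall v, \forall x \ae mu, pnorm (Phi v) x <= pnorm v x.

Definition isomorphic (M N : premodule mu) : Prop :=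
  exists Phi : M -> N,
    [/\ linear Phi, bijective Phi & forall v, pnorm (Phi v) = pnorm v].

(* The universal property of the direct limit, in the category of normed
   L^0(mu)-modules, of a system (D, phi) indexed by I. The test objects N and
   the limit L are complete; completeness of the D i plays no role. *)
Definition is_direct_limit (I : Type) (le : rel I) (D : I -> premodule mu)
    (phi : forall i j, le i j -> D i -> D j)
    (L : normed_module mu) (c : forall i, D i -> L) : Prop :=
  [/\ forall i, is_morphism (@c i),
      forall i j (ij : le i j) v, c j (phi i j ij v) = c i v &
      forall (N : normed_module mu) (h : forall i, D i -> N),
        (forall i, is_morphism (@h i)) ->
        (forall i j (ij : le i j) v, h j (phi i j ij v) = h i v) ->
        exists! Phi : L -> N,
          is_morphism Phi /\ forall i v, Phi (c i v) = h i v].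

End direct_limits.

(* Gamma_A(E) is determined, up to unique isomorphism, as the direct limit of
   the Gamma_A(E_k), k <= n; is_section_module G c says that G, with the
   canonical maps c, is such a direct limit. *)
Section section_module.
Context d (X : measurableType d) (R : realType).
Variables (m : {measure set X -> \bar R}) (A : set X) (mA : measurable A).
Variables (n : option nat) (E : banach_bundle R A n).

Definition dims_below := {k : nat | dim_le k n}.

Definition trunc_sections (k : dims_below) : premodule (mrestr m mA) :=
  fin_sections m mA (sub_bundle mA E (valP k)).

Definition iota (j k : dims_below) (_ : (val j <= val k)%N)
    (s : trunc_sections j) : trunc_sections k :=
  vsections_emb (val k) s.

Definition is_section_module (G : normed_module (mrestr m mA))
    (c : forall k : dims_below, trunc_sections k -> G) : Prop :=
  is_direct_limit (le := fun j k : dims_below => (val j <= val k)%N) iota c.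

End section_module.

(* The extension of a (normed) L^0(m_A)-module to an L^0(m)-module: functions
   act by restriction to A, and the pointwise norm is extended by 0. *)
Section extension.
Context d (X : measurableType d) (R : realType).
Variables (m : {measure set X -> \bar R}) (A : set X) (mA : measurable A).

Local Notation mu := (mrestr m mA).

Definition L0_res (f : L0 m) : L0 mu := ae_class mu (ae_class_measurable f).

Let mext (f : L0 mu) : measurable_fun setT ((f : X -> R) \_ A).
Proof.
by apply/(measurable_restrictT _ mA)/measurable_funTS; exact: ae_class_measurable.
Qed.

Definition L0_ext (f : L0 mu) : L0 m := ae_class m (mext f).

Lemma L0_resE f : \forall x \ae m, A x -> L0_res f x = f x.
Proof. by apply/(ae_mrestr m mA); exact: ae_class_repr. Qed.

Lemma L0_extE f : \forall x \ae m, L0_ext f x = ((f : X -> R) \_ A) x.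
Proof. exact: ae_class_repr. Qed.

Lemma L0_extP (f g : L0 mu) :
  (\forall x \ae m, A x -> f x = g x) -> f = g.
Proof. by move/(ae_mrestr m mA)/L0P. Qed.

Let res_ae f : \forall x \ae mu, L0_res f x = f x.
Proof. exact: ae_class_repr. Qed.

Lemma L0_res1 : L0_res 1 = 1.
Proof.
apply: L0P; near=> x; rewrite (near (res_ae 1) x)// (near (L0_1E mu) x)//.
near: x; apply/ae_mrestr; near=> x => _; exact: (near (L0_1E m) x).
Unshelve. all: by end_near. Qed.

Lemma L0_resM f g : L0_res (f * g) = L0_res f * L0_res g.
Proof.
apply: L0P; near=> x; rewrite (near (res_ae (f * g)) x)//.
rewrite (near (L0_ME (L0_res f) (L0_res g)) x)//.
rewrite (near (res_ae f) x)// (near (res_ae g) x)//.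
near: x; apply/ae_mrestr; near=> x => _; exact: (near (L0_ME f g) x).
Unshelve. all: by end_near. Qed.

Lemma L0_resD f g : L0_res (f + g) = L0_res f + L0_res g.
Proof.
apply: L0P; near=> x; rewrite (near (res_ae (f + g)) x)//.
rewrite (near (L0_DE (L0_res f) (L0_res g)) x)//.
rewrite (near (res_ae f) x)// (near (res_ae g) x)//.
near: x; apply/ae_mrestr; near=> x => _; exact: (near (L0_DE f g) x).
Unshelve. all: by end_near. Qed.

Variable N : premodule mu.

Definition ext_carrier : Type := N.
HB.instance Definition _ := GRing.Zmodule.copy ext_carrier N.

Definition ext_scale (f : L0 m) (v : ext_carrier) : ext_carrier :=
  L0_res f *: (v : N).

Let extA f g v : ext_scale f (ext_scale g v) = ext_scale (f * g) v.
Proof. by rewrite /ext_scale L0_resM scalerA. Qed.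
Let ext1 : left_id 1 ext_scale.
Proof. by move=> v; rewrite /ext_scale L0_res1 scale1r. Qed.
Let extDr : right_distributive ext_scale +%R.
Proof. by move=> f u v; exact: scalerDr. Qed.
Let extDl v : {morph ext_scale^~ v : f g / f + g}.
Proof. by move=> f g; rewrite /ext_scale L0_resD; exact: scalerDl. Qed.

HB.instance Definition _ := GRing.Zmodule_isLmodule.Build (L0 m) ext_carrier
  extA ext1 extDr extDl.

Definition ext_norm (v : ext_carrier) : L0 m := L0_ext (pnorm (v : N)).

Lemma ext_normE v : \forall x \ae m,
  ext_norm v x = ((pnorm (v : N) : X -> R) \_ A) x.
Proof. exact: L0_extE. Qed.

Let ext_norm_ge0 v : \forall x \ae m, 0 <= ext_norm v x.
Proof.
have /(ae_mrestr m mA) v0 := pnorm_ge0 (v : N).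
near=> x; rewrite (near (ext_normE v) x)// patchE; case: ifPn => // /set_mem.
exact: (near v0 x).
Unshelve. all: by end_near. Qed.

Let ext_norm_eq0 v : ext_norm v = 0 <-> v = 0.
Proof.
split=> [v0|->].
  apply/(pnorm_eq0 (v : N)); apply: L0_extP.
  have /(ae_mrestr m mA) zE := L0_0E mu.
  have vE := ext_normE v; rewrite v0 in vE.
  near=> x => Ax; have <- : ((pnorm (v : N) : X -> R) \_ A) x = pnorm (v : N) x.
    by rewrite patchE mem_set.
  by rewrite -(near vE x)// (near (L0_0E m) x)// (near zE x).
have /(ae_mrestr m mA) zE := L0_0E mu.
apply: L0P; near=> x.
rewrite (near (ext_normE 0) x)// (near (L0_0E m) x)// patchE.
case: ifPn => // /set_mem Ax.
have -> : pnorm (0 : N) = 0 by apply/pnorm_eq0.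
exact: (near zE x).
Unshelve. all: by end_near. Qed.

Let ext_normD v w :
  \forall x \ae m, ext_norm (v + w) x <= ext_norm v x + ext_norm w x.
Proof.
have /(ae_mrestr m mA) vw := ler_pnormD (v : N) w.
near=> x; rewrite (near (ext_normE v) x)// (near (ext_normE w) x)//.
rewrite (near (ext_normE (v + w)) x)// !patchE.
case: ifPn => [/set_mem Ax|]; last by rewrite addr0.
exact: (near vw x).
Unshelve. all: by end_near. Qed.

Let ext_normZ f v : ext_norm (f *: v) = L0_abs f * ext_norm v.
Proof.
have /(ae_mrestr m mA) fE := L0_ME (L0_abs (L0_res f)) (pnorm (v : N)).
have /(ae_mrestr m mA) aE := L0_absE (L0_res f).
apply: L0P; near=> x.
rewrite (near (ext_normE (f *: v)) x)// (near (L0_ME (L0_abs f) (ext_norm v)) x)//.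
rewrite (near (ext_normE v) x)// (near (L0_absE f) x)// !patchE.
case: ifPn => [/set_mem Ax|]; last by rewrite mulr0.
have -> : pnorm (f *: v : N) = L0_abs (L0_res f) * pnorm (v : N).
  exact: pnormZ.
by rewrite (near fE x)// (near aE x)// (near (L0_resE f) x).
Unshelve. all: by end_near. Qed.

Definition ext_premodule : premodule m := @Premodule _ _ _ m
  ext_carrier ext_norm ext_norm_ge0 ext_norm_eq0 ext_normD ext_normZ.

End extension.

Section dependent_product.
Variables (S : pzRingType) (I : Type) (M : I -> lmodType S).

Definition dprod : Type := forall i, M i.
Implicit Types u v w : dprod.

HB.instance Definition _ := gen_eqMixin dprod.
HB.instance Definition _ := gen_choiceMixin dprod.

Let add u v : dprod := fun i => u i + v i.
Let opp u : dprod := fun i => - u i.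
Let zero : dprod := fun i => 0.
Let scale (a : S) u : dprod := fun i => a *: u i.

Let addA : associative add.
Proof. by move=> u v w; apply: functional_extensionality_dep => i; exact: addrA. Qed.
Let addC : commutative add.
Proof. by move=> u v; apply: functional_extensionality_dep => i; exact: addrC. Qed.
Let add0 : left_id zero add.
Proof. by move=> u; apply: functional_extensionality_dep => i; exact: add0r. Qed.
Let addN : left_inverse zero opp add.
Proof. by move=> u; apply: functional_extensionality_dep => i; exact: addNr. Qed.

HB.instance Definition _ := GRing.isZmodule.Build dprod addA addC add0 addN.

Let scaleA a b u : scale a (scale b u) = scale (a * b) u.
Proof. by apply: functional_extensionality_dep => i; exact: scalerA. Qed.
Let scale1 : left_id 1 scale.
Proof. by move=> u; apply: functional_extensionality_dep => i; exact: scale1r. Qed.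
Let scaleDr : right_distributive scale +%R.
Proof. by move=> a u v; apply: functional_extensionality_dep => i; exact: scalerDr. Qed.
Let scaleDl u : {morph scale^~ u : a b / a + b}.
Proof. by move=> a b; apply: functional_extensionality_dep => i; exact: scalerDl. Qed.

HB.instance Definition _ := GRing.Zmodule_isLmodule.Build S dprod
  scaleA scale1 scaleDr scaleDl.

End dependent_product.

Section separable_bundles.
Context d (X : measurableType d) (R : realType).

(* A separable Banach bundle over X; the sets of the partition may be empty. *)
Record separable_bundle := SeparableBundle {
  sb_base : option nat -> set X ;
  sb_measurable : forall n, measurable (sb_base n) ;
  sb_trivIset : trivIset setT sb_base ;
  sb_cover : \bigcup_n sb_base n = setT ;
  sb_bundle : forall n, banach_bundle R (sb_base n) n }.

Variables (m : {measure set X -> \bar R}) (E : separable_bundle).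

(* A choice, for every n, of the direct limit defining the space of sections of
   the n-dimensional part of E *)
Record section_spaces := SectionSpaces {
  ss_module : forall n, normed_module (mrestr m (sb_measurable E n)) ;
  ss_in : forall n (k : dims_below n),
    trunc_sections m (sb_measurable E n) (sb_bundle E n) k -> ss_module n ;
  ss_limit : forall n, is_section_module (@ss_in n) }.

Variable G : section_spaces.

Definition Gamma_factor (n : option nat) : premodule m :=
  ext_premodule (ss_module G n).

Definition Gamma_carrier : lmodType (L0 m) := dprod Gamma_factor.

(* At most one term of this sum is nonzero at each x, as the base sets are
   disjoint, so that the finitely supported sum is the full sum. *)
Definition Gamma_pointwise (s : Gamma_carrier) (x : X) : R :=
  \sum_(n \in [set: option nat]) \1_(sb_base E n) x * pnorm (s n) x.

Lemma Gamma_pointwiseE (s : Gamma_carrier) n x : sb_base E n x ->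
  Gamma_pointwise s x = pnorm (s n) x.
Proof.
move=> Anx; rewrite /Gamma_pointwise -(@fsbig_widen _ _ _ _ [set n])//.
  by rewrite fsbig_set1 indicE mem_set// mul1r.
move=> k [_ /= kn]; rewrite indicE memNset ?mul0r// => Akx.
by apply: kn; apply: (@sb_trivIset E k n I I); exists x.
Qed.

Lemma Gamma_in x : exists n, sb_base E n x.
Proof. by have : [set: X] x by []; rewrite -(sb_cover E) => -[n _]; exists n. Qed.

Lemma Gamma_measurable s : measurable_fun setT (Gamma_pointwise s).
Proof.
move=> _ Y mY; rewrite setTI.
rewrite (_ : _ @^-1` Y =
    \bigcup_n (sb_base E n `&` (pnorm (s n) : X -> R) @^-1` Y)).
  apply: countable_bigcupT_measurable => [|n]; first exact: countableP.
  apply: measurableI; first exact: sb_measurable.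
  by rewrite -[X in measurable X]setTI; apply: (ae_class_measurable (pnorm (s n))).
apply/seteqP; split => [x /= Yx|x [n _ [Anx]] /=].
  have [n Anx] := Gamma_in x.
  by exists n => //; split => //=; rewrite -(Gamma_pointwiseE s Anx).
by rewrite (Gamma_pointwiseE s Anx).
Qed.

Definition Gamma_norm (s : Gamma_carrier) : L0 m :=
  ae_class m (Gamma_measurable s).

Lemma Gamma_normE s n :
  \forall x \ae m, sb_base E n x -> Gamma_norm s x = pnorm (s n) x.
Proof.
have nE : \forall x \ae m, Gamma_norm s x = Gamma_pointwise s x.
  exact: ae_class_repr.
by apply: filterS nE => x -> Anx; exact: Gamma_pointwiseE.
Qed.

Lemma ae_cover (P : set X) :
  (forall n, \forall x \ae m, sb_base E n x -> P x) -> \forall x \ae m, P x.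
Proof.
move=> PE.
have /ae_foralln H k : \forall x \ae m, forall n : option nat,
    unpickle k = Some n -> sb_base E n x -> P x.
  case: (unpickle k) => [n|]; last exact: aeW.
  by apply: filterS (PE n) => x Px _ [<-].
apply: filterS H => x Px; have [n Anx] := Gamma_in x.
exact: (Px (pickle n) n (pickleK n) Anx).
Qed.

Let Gamma_norm_ge0 s : \forall x \ae m, 0 <= Gamma_norm s x.
Proof.
apply: ae_cover => n; near=> x => Anx.
rewrite (near (Gamma_normE s n) x)//; exact: (near (pnorm_ge0 (s n)) x).
Unshelve. all: by end_near. Qed.

Let Gamma_norm_eq0 s : Gamma_norm s = 0 <-> s = 0.
Proof.
split=> [s0|->].
  apply: functional_extensionality_dep => n; apply/pnorm_eq0/L0P.
  near=> x; rewrite (near (L0_0E m) x)//.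
  have [Anx|nAnx] := pselect (sb_base E n x).
    by rewrite -(near (Gamma_normE s n) x)// s0 (near (L0_0E m) x).
  rewrite [LHS](near (ext_normE (s n : ext_carrier (ss_module G n))) x)//.
  by rewrite patchE memNset.
apply: L0P; apply: ae_cover => n; near=> x => Anx.
rewrite (near (Gamma_normE 0 n) x)//.
by have -> : pnorm ((0 : Gamma_carrier) n) = 0 by apply/pnorm_eq0.
Unshelve. all: by end_near. Qed.

Let Gamma_normD s t :
  \forall x \ae m, Gamma_norm (s + t) x <= Gamma_norm s x + Gamma_norm t x.
Proof.
apply: ae_cover => n; near=> x => Anx.
rewrite (near (Gamma_normE s n) x)// (near (Gamma_normE t n) x)//.
rewrite (near (Gamma_normE (s + t) n) x)//.
exact: (near (ler_pnormD (s n) (t n)) x).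
Unshelve. all: by end_near. Qed.

Let Gamma_normZ f s : Gamma_norm (f *: s) = L0_abs f * Gamma_norm s.
Proof.
apply: L0P; apply: ae_cover => n; near=> x => Anx.
rewrite (near (L0_ME (L0_abs f) (Gamma_norm s)) x)//.
rewrite (near (Gamma_normE (f *: s) n) x)// (near (Gamma_normE s n) x)//.
have -> : pnorm ((f *: s : Gamma_carrier) n) = L0_abs f * pnorm (s n).
  exact: pnormZ.
exact: (near (L0_ME (L0_abs f) (pnorm (s n))) x).
Unshelve. all: by end_near. Qed.

(* Gamma(E) = \prod_n Ext_{A_n}(Gamma_{A_n}(E_n)). *)
Definition Gamma : premodule m := @Premodule _ _ _ m Gamma_carrier
  Gamma_norm Gamma_norm_ge0 Gamma_norm_eq0 Gamma_normD Gamma_normZ.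

End separable_bundles.

Section separability.
Context d (X : measurableType d) (R : realType).

(* As for pcomplete, separability does not depend on P. *)
Definition separable_module (mu : {measure set X -> \bar R})
    (M : premodule mu) : Prop :=
  forall P : probability X R, mu `<< P -> P `<< mu ->
  exists D : set M, countable D /\
    forall v e, 0 < e -> exists2 w, D w & pdist P v w < e.

End separability.

(* Main.v *)
From HB Require Import structures.
Require Import Defs.
From mathcomp Require Import all_boot all_order all_algebra.
From mathcomp Require Import all_classical all_reals all_analysis.
From mathcomp Require Import measurable_realfun ring lra.

(** A dense sequence [w] of the module is reduced, by a measurable Gram-Schmidt
    selection, to a sequence [v] and measurable sets [S l] such that, at almost
    every [x] of [S l], [v l] is at positive distance from the rational span of
    [v 0, ..., v (l - 1)], while off [S l] every [w i] lies in the closure of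
    that span.  The dimension at [x] is the first [l] with [x] outside [S l], and
    the norm of the fibre at [x] is the continuous extension to real coefficients
    of the countably many pointwise norms of rational combinations of the [v l].
    On the set [A] of points of dimension [n], sections of finite length map
    isometrically into the restriction [chi_A M] of the module, with dense image;
    extending morphisms by density shows that [chi_A M] is their direct limit, and
    the module is glued from its restrictions.

    Reference probability measures are eliminated early.  Density is used in the
    form: for a.e. [x] and every [e > 0], some member of the sequence is [e]-close
    at [x].  Completeness is used through [ae_limit], which yields both countable
    gluing and limits of uniformly Cauchy sequences. *)

Set Implicit Arguments.
Unset Strict Implicit.
Unset Printing Implicit Defensive.

Import Order.TTheory GRing.Theory Num.Theory.
Import numFieldNormedType.Exports.

Local Open Scope classical_set_scope.
Local Open Scope ring_scope.

(** * Almost everywhere statements and pointwise norms *)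

Section countable_quantifiers.
Context d (X : measurableType d).

Lemma measurable_exists (I : countType) (P : I -> X -> Prop) :
  (forall i, measurable [set x | P i x]) -> measurable [set x | exists i, P i x].
Proof.
move=> mP; rewrite (_ : [set _ | _] = \bigcup_i [set x | P i x]).
  exact: countable_bigcupT_measurable.
by apply/seteqP; split => x /= [i Pi]; exists i.
Qed.

Lemma measurable_not (P : X -> Prop) :
  measurable [set x | P x] -> measurable [set x | ~ P x].
Proof. exact: measurableC. Qed.

Lemma measurable_forall (I : countType) (P : I -> X -> Prop) :
  (forall i, measurable [set x | P i x]) -> measurable [set x | forall i, P i x].
Proof.
move=> mP; rewrite (_ : [set _ | _] = [set x | ~ exists i, ~ P i x]).
  by apply/measurable_not/measurable_exists => i; exact: measurable_not.
apply/seteqP; split => x /= H; first by case=> i; exact.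
by move=> i; apply: contra_notP H => ?; exists i.
Qed.

End countable_quantifiers.

Section almost_everywhere.
Context d (X : measurableType d) (R : realType).
Variable mu : {measure set X -> \bar R}.

Lemma ae_forall_count (I : countType) (P : I -> X -> Prop) :
  (forall i, \forall x \ae mu, P i x) -> \forall x \ae mu, forall i, P i x.
Proof.
move=> H.
have /ae_foralln : forall k, \forall x \ae mu,
    (if unpickle k is Some i then P i x else True).
  by move=> k; case: (unpickle k) => [i|]; [exact: H|exact: aeW].
by apply: filterS => x Px i; have := Px (pickle i); rewrite pickleK.
Qed.

Lemma inv_succ_lt (e : R) : 0 < e -> exists n : nat, n.+1%:R^-1 < e.
Proof.
move=> e0; have [n _ /(_ _ (leqnn n)) H] := near_infty_natSinv_lt (PosNum e0).
by exists n.
Qed.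

(** Monotonicity in [e] reduces the uncountable family of tolerances to the values 1/(n+1), so
    countably many null sets are discarded. *)
Lemma ae_forall_eps (P : R -> X -> Prop) :
  (forall e e' x, e <= e' -> P e x -> P e' x) ->
  (forall e, 0 < e -> \forall x \ae mu, P e x) ->
  \forall x \ae mu, forall e, 0 < e -> P e x.
Proof.
move=> Pmono H.
have /ae_foralln : forall n : nat, \forall x \ae mu, P n.+1%:R^-1 x.
  by move=> n; apply: H; rewrite invr_gt0.
apply: filterS => x Px e /inv_succ_lt[n /ltW ne].
exact: Pmono ne (Px n).
Qed.

End almost_everywhere.

Section indicator_class.
Context d (X : measurableType d) (R : realType).
Variable mu : {measure set X -> \bar R}.

Definition L0_ind (A : set X) (mA : measurable A) : L0 mu :=
  ae_class mu (measurable_indic mA).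

Lemma L0_indE (A : set X) (mA : measurable A) :
  \forall x \ae mu, L0_ind mA x = \1_A x.
Proof. exact: ae_class_repr. Qed.

End indicator_class.

Section pointwise_norm.
Context d (X : measurableType d) (R : realType).
Variables (mu : {measure set X -> \bar R}) (M : premodule mu).
Implicit Types (u v w : M) (f : L0 mu).

Lemma measurable_pnorm v : measurable_fun setT (pnorm v : X -> R).
Proof. exact: (ae_class_measurable (pnorm v)). Qed.

Lemma measurable_pnorm_ge v e : measurable [set x | e <= pnorm v x].
Proof.
rewrite -[X in measurable X]setTI.
exact: (measurable_fun_le _ (measurable_cst _) (measurable_pnorm v)).
Qed.

Lemma measurable_pnorm_lt v e : measurable [set x | pnorm v x < e].
Proof.
rewrite (_ : [set _ | _] = [set x | ~ e <= pnorm v x]).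
  exact/measurable_not/measurable_pnorm_ge.
by apply/seteqP; split => x /=; rewrite ltNge => /negP.
Qed.

Lemma pnormZE f v : \forall x \ae mu, pnorm (f *: v) x = `|f x| * pnorm v x.
Proof.
rewrite pnormZ; near=> x.
by rewrite (near (L0_ME (L0_abs f) (pnorm v)) x)// (near (L0_absE f) x).
Unshelve. all: by end_near. Qed.

Lemma pnorm0 : pnorm (0 : M) = 0. Proof. exact/pnorm_eq0. Qed.

Lemma pnorm0E : \forall x \ae mu, pnorm (0 : M) x = 0.
Proof. by rewrite pnorm0; exact: L0_0E. Qed.

Lemma pnormN v : pnorm (- v) = pnorm v.
Proof.
rewrite -scaleN1r; apply: L0P; near=> x.
rewrite (near (pnormZE (-1) v) x)// (near (L0_NE (1 : L0 mu)) x)//.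
by rewrite (near (L0_1E mu) x)// normrN1 mul1r.
Unshelve. all: by end_near. Qed.

Lemma pnormB_sym v w : pnorm (v - w) = pnorm (w - v).
Proof. by rewrite -pnormN opprB. Qed.

Lemma pnorm_triangle u v w :
  \forall x \ae mu, pnorm (v - w) x <= pnorm (v - u) x + pnorm (u - w) x.
Proof. by rewrite -(subrKA u); exact: ler_pnormD. Qed.

Lemma pnorm_dist v w : \forall x \ae mu,
  `|pnorm v x - pnorm w x| <= pnorm (v - w) x.
Proof.
have h1 := ler_pnormD (v - w) w; rewrite subrK in h1.
have h2 := ler_pnormD (w - v) v; rewrite subrK pnormB_sym in h2.
apply: filterS2 h1 h2 => x h1 h2.
by rewrite ler_distl; apply/andP; split; lra.
Qed.

Lemma pnorm_ae_eq0 v : (\forall x \ae mu, pnorm v x = 0) -> v = 0.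
Proof.
move=> v0; apply/pnorm_eq0/L0P; apply: filterS2 v0 (L0_0E mu) => x -> -> //.
Qed.

Lemma pnorm_ae_eq v w : (\forall x \ae mu, pnorm (v - w) x = 0) -> v = w.
Proof. by move/pnorm_ae_eq0/eqP; rewrite subr_eq0 => /eqP. Qed.

Lemma pnorm_sum k (F : nat -> M) : \forall x \ae mu,
  pnorm (\sum_(i < k) F i) x <= \sum_(i < k) pnorm (F i) x.
Proof.
elim: k => [|k IHk].
  rewrite big_ord0; apply: filterS pnorm0E => x ->.
  by rewrite big_ord0.
rewrite big_ord_recr/=.
apply: filterS2 IHk (ler_pnormD (\sum_(i < k) F i) (F k)) => x h1 h2.
by rewrite big_ord_recr/=; lra.
Qed.

End pointwise_norm.

(** * Elimination of the reference probability *)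

Section distance.
Context d (X : measurableType d) (R : realType).
Variables (mu : {measure set X -> \bar R}) (P : probability X R).
Hypotheses (muP : mu `<< P) (Pmu : P `<< mu).
Variable M : premodule mu.
Implicit Types u v w : M.

(** The integrand of [pdist] subtracts a representative of the class 0, which vanishes only almost
    everywhere; [tnorm] omits it. *)
Definition tnorm v (x : X) : R := Num.min `|pnorm v x| 1.

Lemma tnorm_measurable v : measurable_fun setT (tnorm v).
Proof.
by apply: measurable_minr => //; exact: measurableT_comp.
Qed.

Lemma tnorm_ge0 v x : 0 <= tnorm v x.
Proof. by rewrite le_min normr_ge0 ler01. Qed.

Lemma tnorm_le1 v x : tnorm v x <= 1.
Proof. by rewrite ge_min lexx orbT. Qed.

Lemma ae_dominated (Q : X -> Prop) :
  (\forall x \ae mu, Q x) -> \forall x \ae P, Q x.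
Proof.
move/null_content_dominatesP : Pmu => Pmu' [N [mN N0 QN]].
by exists N; split => //; exact: Pmu'.
Qed.

Lemma pdistE v w : (pdist P v w)%:E = (\int[P]_x (tnorm (v - w) x)%:E)%E.
Proof.
have bnd : P.-integrable setT (EFin \o tnorm (v - w)).
  apply: (@le_integrable _ _ _ P _ measurableT _ (EFin \o cst 1)).
  - by apply/measurable_EFinP; exact: tnorm_measurable.
  - move=> x _ /=; rewrite ger0_norm ?tnorm_ge0// normr1 lee_fin.
    exact: tnorm_le1.
  - exact: finite_measure_integrable_cst.
have -> : (\int[P]_x (tnorm (v - w) x)%:E)%E =
    (\int[P]_x (Num.min `|pnorm (v - w) x - (0 : L0 mu) x| 1)%:E)%E.
  apply: ae_eq_integral => //.
  - by apply/measurable_EFinP; exact: tnorm_measurable.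
  - apply/measurable_EFinP; apply: measurable_minr => //.
    apply: measurableT_comp => //; apply: measurable_funB.
      exact: measurable_pnorm.
    exact: ae_class_measurable.
  - apply: filterS (ae_dominated (L0_0E mu)) => x x0 _.
    by rewrite x0 subr0.
rewrite /pdist /L0_dist /Rintegral fineK//.
rewrite -[X in X \is a fin_num](_ : (\int[P]_x (tnorm (v - w) x)%:E)%E = _).
  exact: integrable_fin_num.
apply: ae_eq_integral => //.
- by apply/measurable_EFinP; exact: tnorm_measurable.
- apply/measurable_EFinP; apply: measurable_minr => //.
  apply: measurableT_comp => //; apply: measurable_funB.
    exact: measurable_pnorm.
  exact: ae_class_measurable.
- apply: filterS (ae_dominated (L0_0E mu)) => x x0 _.
  by rewrite x0 subr0.
Qed.

Lemma pdist_le v w v' w' :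
  (\forall x \ae mu, pnorm (v - w) x <= pnorm (v' - w') x) ->
  pdist P v w <= pdist P v' w'.
Proof.
move=> H; rewrite -lee_fin !pdistE; apply: ae_ge0_le_integral => //.
- by move=> x _; rewrite lee_fin tnorm_ge0.
- by apply/measurable_EFinP; exact: tnorm_measurable.
- by move=> x _; rewrite lee_fin tnorm_ge0.
- by apply/measurable_EFinP; exact: tnorm_measurable.
apply: filterS2 (ae_dominated H) (ae_dominated (pnorm_ge0 (v - w))) => x Hx H0 _.
rewrite lee_fin /tnorm le_min !ge_min lexx orbT andbT ger0_norm//.
by rewrite (le_trans Hx)// ler_norm.
Qed.

(** Markov's inequality. The threshold is [Num.min e 1] because the truncated integrand never
    exceeds 1. *)
Lemma pdist_markov v w e : 0 < e ->
  ((Num.min e 1)%:E * P [set x | (e <= pnorm (v - w) x)%R] <= (pdist P v w)%:E)%E.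
Proof.
move=> e0; rewrite pdistE.
have e10 : 0 < Num.min e 1 by rewrite lt_min e0 ltr01.
have mt : measurable_fun setT (EFin \o tnorm (v - w)).
  by apply/measurable_EFinP; exact: tnorm_measurable.
have := @le_integral_comp_abse _ _ _ P setT measurableT _ (Num.min e 1) id
  (@measurable_id _ _ _) (fun _ h => h) _ mt e10.
move=> /(_ (fun _ _ _ _ h => h)) H.
have -> : (\int[P]_x (tnorm (v - w) x)%:E =
    \int[P]_x `|(EFin \o tnorm (v - w)) x|)%E.
  by apply: eq_integral => x _ /=; rewrite ger0_norm// tnorm_ge0.
apply: le_trans H; rewrite lee_pmul2l//.
apply: le_measure; rewrite ?inE.
- exact: measurable_pnorm_ge.
- rewrite setTI -[X in measurable X]setTI.
  apply: (emeasurable_fun_c_infty) => //; exact: measurableT_comp.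
- move=> x /= ex; split => //; rewrite lee_fin ger0_norm ?tnorm_ge0//.
  rewrite /tnorm le_min !ge_min lexx orbT andbT.
  by rewrite (le_trans ex)//= ler_norm.
Qed.

(** For fixed [e], the set [B] where every [u i] stays at distance at least [e] is measurable since
    [I] is countable. Markov's inequality bounds [P B] by every positive [r], so [B] is null for
    [P], hence for [mu]. *)
Lemma ae_close (I : countType) (u : I -> M) v :
  (forall e, 0 < e -> exists i, pdist P v (u i) < e) ->
  \forall x \ae mu, forall e, 0 < e -> exists i, pnorm (v - u i) x < e.
Proof.
move=> uv; apply: ae_forall_eps.
  by move=> e e' x ee' [i ie]; exists i; exact: lt_le_trans ee'.
move=> e e0; pose B := [set x | forall i, e <= pnorm (v - u i) x].
have mB : measurable B.
  apply: measurable_forall => i; exact: measurable_pnorm_ge.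
have B0 : P B = 0%E.
  apply/eqP; rewrite eq_le measure_ge0 andbT; apply/lee_addgt0Pr => r r0.
  rewrite add0e.
  have e10 : 0 < Num.min e 1 by rewrite lt_min e0 ltr01.
  (* This tolerance leaves exactly [r] after division by the factor of Markov's inequality. *)
  have [|i ie] := uv (r * Num.min e 1); first exact: mulr_gt0.
  have := pdist_markov v (u i) e0; rewrite muleC -lee_pdivlMr//.
  move=> H; apply: (@le_trans _ _ (P [set x | e <= pnorm (v - u i) x])).
    apply: le_measure; rewrite ?inE//; first exact: measurable_pnorm_ge.
    by move=> x; exact.
  apply: le_trans H _; rewrite lee_pdivrMr// -EFinM lee_fin; exact: ltW.
exists B; split => //; first by move/null_content_dominatesP : muP; exact.
move=> x /= /forallNP H i; rewrite leNgt; apply/negP; exact: H.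
Qed.

End distance.

(** * Completeness: almost everywhere limits and countable gluing *)

Section completeness.
Context d (X : measurableType d) (R : realType).

(* The null measure is dominated by no probability measure, but its modules are
   trivial. *)
Definition admissible (mu : {measure set X -> \bar R}) :=
  mu setT = 0%E \/ exists P : probability X R, mu `<< P /\ P `<< mu.

Lemma ae_trivial (mu : {measure set X -> \bar R}) (Q : X -> Prop) :
  mu setT = 0%E -> \forall x \ae mu, Q x.
Proof. by move=> mu0; exists setT; split. Qed.

Variable mu : {measure set X -> \bar R}.
Hypothesis adm : admissible mu.
Variable M : normed_module mu.

Section limit.
Variables (u : nat -> M) (k : X -> nat) (r : nat -> R).
Hypothesis mk : forall i, measurable [set x | (k x <= i)%N].
Hypothesis r0 : r @ \oo --> 0.
Hypothesis ur : forall i j, (i <= j)%N ->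
  \forall x \ae mu, (k x <= i)%N -> pnorm (u i - u j) x <= r i.

Let S i := [set x | (i < k x)%N].

Let mS i : measurable (S i).
Proof.
rewrite (_ : S i = [set x | ~ (k x <= i)%N]); first exact: measurable_not.
apply/seteqP; split => x; rewrite /S/= ltnNge; first by move/negP.
by move=> H; apply/negP.
Qed.

(** Off [S i] the integrand is at most the rate [r i]; on [S i] the truncation bounds it by 1. *)
Let pdist_le (P : probability X R) : mu `<< P -> P `<< mu ->
  forall i j, (i <= j)%N -> ((pdist P (u i) (u j))%:E <= (`|r i|)%:E + P (S i))%E.
Proof.
move=> muP Pmu i j ij; rewrite pdistE//.
have -> : ((`|r i|)%:E + P (S i) =
    \int[P]_x ((`|r i|)%:E + (\1_(S i) x)%:E))%E.
  rewrite ge0_integralD//; last first.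
    by apply/measurable_EFinP; exact: measurable_indic.
  rewrite integral_cst// integral_indic// setIT -[in LHS](mule1 (`|r i|)%:E).
  by congr (_ * _ + _)%E; apply: esym; exact: (@probability_setT _ _ _ P).
apply: ae_ge0_le_integral => //.
- by move=> x _; rewrite lee_fin tnorm_ge0.
- by apply/measurable_EFinP; exact: tnorm_measurable.
- by move=> x _; rewrite adde_ge0// lee_fin.
- apply: emeasurable_funD => //.
  by apply/measurable_EFinP; exact: measurable_indic.
have H := ae_dominated Pmu (ur ij).
have H0 := ae_dominated Pmu (pnorm_ge0 (u i - u j)).
apply: filterS2 H H0 => x H H0 _; rewrite -EFinD lee_fin indicE.
have [Sx|Sx] := pselect (S i x).
  by rewrite mem_set// (le_trans (tnorm_le1 _ _))// lerDr.
rewrite memNset// addr0 /tnorm ge_min ger0_norm//.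
have {}/H H : (k x <= i)%N by rewrite leqNgt; exact/negP.
by rewrite (le_trans H)// ler_norm.
Qed.

(** The rate [r i] is available at [x] only from the index [k x] on. The exceptional sets [S i]
    decrease to the empty set, so their [P]-measure tends to 0 and the sequence is Cauchy for
    [pdist]; the pointwise rate then passes to the limit. *)
Lemma ae_limit : exists v, forall i,
  \forall x \ae mu, (k x <= i)%N -> pnorm (u i - v) x <= r i.
Proof.
case: adm => [mu0|[P [muP Pmu]]].
  by exists 0 => i; exact: ae_trivial.
have [||e e0|v uv] := @nm_complete _ _ _ _ M P _ _ u; [exact: muP|exact: Pmu| |].
  have e2 : 0 < e / 2 by rewrite divr_gt0.
  have [N1 _ HN1] : \forall n \near \oo, `|r n| < e / 2.
    by move/cvgr0Pnorm_lt : r0; apply.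
  have SS : (P \o S) @ \oo --> 0%E.
    rewrite -[X in _ --> X](measure0 P).
    have <- : \bigcap_n S n = set0.
      by apply/seteqP; split => // x /(_ (k x) I); rewrite /S/= ltnn.
    apply: nonincreasing_cvg_mu => //.
    - by rewrite -ge0_fin_numE// fin_num_measure.
    - exact: bigcapT_measurable.
    - by move=> a b ab; apply/subsetPset => x; rewrite /S/=; exact: leq_ltn_trans.
  have [N2 _ HN2] : \forall n \near \oo, (P (S n) < (e / 2)%:E)%E.
    move: SS => /fine_cvgP[_] /cvgr0Pnorm_lt/(_ _ e2).
    apply: filterS => n /=; rewrite ger0_norm ?fine_ge0// => H.
    by rewrite -[P (S n)]fineK ?lte_fin// fin_num_measure.
  have key i j : (maxn N1 N2 <= i)%N -> (i <= j)%N -> pdist P (u i) (u j) < e.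
    rewrite geq_max => /andP[N1i N2i] ij.
    rewrite -lte_fin; apply: le_lt_trans (pdist_le muP Pmu ij) _.
    rewrite [e in (_ < e%:E)%E]splitr EFinD lteD//; last exact: HN2.
    by rewrite lte_fin; exact: HN1.
  exists (maxn N1 N2) => i j iN jN.
  have [ij|/ltnW ji] := leqP i j; first exact: key.
  rewrite /pdist pnormB_sym; exact: key.
exists v => i.
have : \forall x \ae mu, forall e, 0 < e -> exists j, pnorm (v - u (i + j)%N) x < e.
  apply: (ae_close muP Pmu) => e e0.
  move/cvgr0Pnorm_lt : uv => /(_ e e0)[N _ /(_ (i + N)%N)].
  rewrite /= leq_addl => /(_ isT) H; exists N.
  rewrite /pdist pnormB_sym; exact: le_lt_trans (ler_norm _) H.
move=> H1.
have H2 : \forall x \ae mu, forall j, (k x <= i)%N ->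
    pnorm (u i - u (i + j)%N) x <= r i.
  by apply: ae_foralln => j; apply: ur; rewrite leq_addr.
have H3 : \forall x \ae mu, forall j,
    pnorm (u i - v) x <= pnorm (u i - u (i + j)%N) x + pnorm (u (i + j)%N - v) x.
  apply: ae_foralln => j; exact: pnorm_triangle.
apply: filterS3 H1 H2 H3 => x H1 H2 H3 kx; apply/ler_addgt0Pr => e e0.
have [j vj] := H1 e e0; apply: le_trans (H3 j) _; apply: lerD; first exact: H2.
by rewrite pnormB_sym ltW.
Qed.

End limit.

(** The partial sums of the terms [u i] cut off by the events [k x = i] are stationary at [x] from
    the index [k x] on, so [ae_limit] applies with rate 0. *)
Lemma glue_nat (u : nat -> M) (k : X -> nat) :
  (forall i, measurable [set x | k x = i]) ->
  exists v, \forall x \ae mu, pnorm (v - u (k x)) x = 0.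
Proof.
move=> mk.
pose S n := \sum_(i < n.+1) L0_ind mu (mk i) *: u i.
have SE : \forall x \ae mu, forall n, (k x <= n)%N -> pnorm (S n - u (k x)) x = 0.
  suff : forall n, \forall x \ae mu, forall j : 'I_n.+1, k x = j ->
      pnorm (S n - u j) x = 0.
    move=> H; have := ae_foralln H; apply: filterS => x {}H n kxn.
    exact: (H n (Ordinal (kxn : (k x < n.+1)%N)) erefl).
  move=> n; apply: ae_forall_count => j.
  (* The coefficient is an indicator minus a Kronecker delta, and vanishes wherever [k x = j]. *)
  pose F i := (L0_ind mu (mk i) - (i == j :> nat)%:R) *: u i.
  have SF : S n - u j = \sum_(i < n.+1) F i.
    rewrite (eq_bigr (fun i : 'I_n.+1 => L0_ind mu (mk i) *: u i -
      (i == j :> nat)%:R *: u i)) => [|i _]; last by rewrite -scalerBl.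
    rewrite sumrB; congr (_ - _); rewrite (bigD1 j)//= eqxx scale1r big1 ?addr0//.
    by move=> i /negbTE ij; rewrite (_ : (i == j :> nat) = false) ?scale0r.
  rewrite SF.
  have H1 : \forall x \ae mu, forall i, pnorm (F i) x =
      `|\1_[set x | k x = i] x - (i == j :> nat)%:R| * pnorm (u i) x.
    apply: ae_foralln => i.
    have H0 : \forall x \ae mu, ((i == j :> nat)%:R : L0 mu) x = (i == j :> nat)%:R.
      by case: (_ == _); [exact: L0_1E|exact: L0_0E].
    have H4 := pnormZE (L0_ind mu (mk i) - (i == j :> nat)%:R) (u i).
    have H3 := L0_DE (L0_ind mu (mk i)) (- (i == j :> nat)%:R).
    have H2 := L0_NE ((i == j :> nat)%:R : L0 mu).
    have H1 := L0_indE mu (mk i).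
    by apply: filterS3 H4 H3 (filterI H2 (filterI H1 H0)) => x -> -> [-> [-> ->]].
  apply: filterS3 H1 (pnorm_sum n.+1 F) (pnorm_ge0 (\sum_(i < n.+1) F i)) => x H1 H2 H3 kx.
  apply/eqP; rewrite eq_le H3 andbT; apply: le_trans H2 _.
  rewrite big1// => i _; rewrite H1 indicE.
  have [ij|/eqP ij] := eqVneq (i : nat) j.
    by rewrite mem_set /= ?ij// subrr normr0 mul0r.
  by rewrite memNset /= ?kx ?subrr ?normr0 ?mul0r// => /esym.
have tri : \forall x \ae mu, forall p : nat * nat,
    pnorm (S p.1 - S p.2) x <= pnorm (S p.1 - u (k x)) x + pnorm (S p.2 - u (k x)) x.
  (* The third index is quantified before being specialised to [k x], so that a single null set
     serves all points. *)
  suff : \forall x \ae mu, forall p : nat * nat * nat,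
    pnorm (S p.1.1 - S p.1.2) x <= pnorm (S p.1.1 - u p.2) x + pnorm (S p.1.2 - u p.2) x.
    by apply: filterS => x H p; exact: (H (p, k x)).
  apply: ae_forall_count => p; rewrite [pnorm (S p.1.2 - _)]pnormB_sym.
  exact: pnorm_triangle.
have [|||v Sv] := @ae_limit S k (fun=> 0).
- move=> i; rewrite (_ : [set _ | _] = [set x | exists j : 'I_i.+1, k x = j]).
    by apply: measurable_exists => j; exact: mk.
  apply/seteqP; split => x /= [].
    by move=> kx; exists (Ordinal (kx : (k x < i.+1)%N)).
  by move=> j ->; rewrite -ltnS.
- exact: cvg_cst.
- move=> i j ij; apply: filterS2 SE tri => x SE tri kx.
  apply: le_trans (tri (i, j)) _; rewrite !SE ?addr0//.
  exact: leq_trans ij.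
exists v; have {}Sv := ae_foralln Sv.
have tri2 : \forall x \ae mu, forall p : nat * nat,
    pnorm (v - u p.1) x <= pnorm (S p.2 - v) x + pnorm (S p.2 - u p.1) x.
  apply: ae_forall_count => p; rewrite [pnorm (S p.2 - v)]pnormB_sym.
  exact: pnorm_triangle.
have pos : \forall x \ae mu, forall i, 0 <= pnorm (v - u i) x.
  by apply: ae_foralln => i; exact: pnorm_ge0.
near=> x; apply/eqP; rewrite eq_le (near pos x)// andbT.
apply: le_trans (near tri2 x _ (k x, k x)) _ => //=.
rewrite (near SE x)// addr0; exact: (near Sv x).
Unshelve. all: by end_near. Qed.

Lemma countable_glue (I : countType) (u : I -> M) (k : X -> I) :
  (forall i, measurable [set x | k x = i]) ->
  exists v, \forall x \ae mu, pnorm (v - u (k x)) x = 0.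
Proof.
move=> mk.
(* Integers that encode no element of [I] receive the value 0; [pickle \o k] never takes them. *)
have [j|v vk] := @glue_nat (fun n => odflt 0 (omap u (unpickle n))) (pickle \o k).
  rewrite (_ : [set _ | _] = [set x | exists i, k x = i /\ pickle i = j]); last first.
    apply/seteqP; split => x /=; first by exists (k x).
    by case=> i [-> ->].
  apply: measurable_exists => i; have [<-|ij] := eqVneq (pickle i) j.
    rewrite (_ : [set _ | _] = [set x | k x = i]); first exact: mk.
    by apply/seteqP; split => x /=; [case|].
  rewrite (_ : [set _ | _] = set0) //; apply/seteqP; split => x //= [_] /eqP.
  by rewrite (negbTE ij).
by exists v; apply: filterS vk => x /=; rewrite pickleK.
Qed.

End completeness.

(** * Extension of morphisms by density *)

Section first_index.
Context d (X : measurableType d) (C : nat -> X -> Prop).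

(** Choosing the least index keeps the selection measurable: the event [k x = Some i] is [C i]
    without the finitely many earlier events. *)
Lemma first_index : (forall i, measurable [set x | C i x]) ->
  exists k : X -> option nat,
    [/\ forall o, measurable [set x | k x = o],
        forall x i, k x = Some i -> C i x /\ forall j, (j < i)%N -> ~ C j x &
        forall x, k x = None -> forall i, ~ C i x].
Proof.
move=> mC.
have /choice[k kP] x : exists o : option nat,
    if o is Some i then C i x /\ forall j, (j < i)%N -> ~ C j x
    else forall i, ~ C i x.
  have [[i Ci]|/forallNP nC] := pselect (exists i, C i x); last by exists None.
  have ex : exists i, `[< C i x >] by exists i; exact/asboolP.
  exists (Some (ex_minn ex)); case: ex_minnP => l /asboolP Cl lmin; split => //.
  by move=> j jl /asboolP/lmin; rewrite leqNgt jl.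
have k1 x i : k x = Some i -> C i x /\ forall j, (j < i)%N -> ~ C j x.
  by move=> kx; have := kP x; rewrite kx.
have k2 x : k x = None -> forall i, ~ C i x.
  by move=> kx; have := kP x; rewrite kx.
exists k; split=> //; case=> [i|].
  rewrite (_ : [set _ | _] = [set x | C i x] `&`
      [set x | forall j : 'I_i, ~ C j x]).
    apply: measurableI; first exact: mC.
    by apply: measurable_forall => j; exact/measurable_not.
  apply/seteqP; split => x /=; first by move/k1 => [Ci Cj]; split => // j; exact: Cj.
  case=> Ci Cj; case kx : (k x) => [l|]; last by have := k2 _ kx i Ci.
  have [Cl Cl'] := k1 _ _ kx; have [li|il|->//] := ltngtP l i.
    by have := Cj (Ordinal li) Cl.
  by have := Cl' _ il Ci.
rewrite (_ : [set _ | _] = [set x | forall i, ~ C i x]).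
  by apply: measurable_forall => j; exact/measurable_not.
apply/seteqP; split => x /=; first by move/k2.
by move=> nC; case kx : (k x) => [l|//]; have [/nC] := k1 _ _ kx.
Qed.

End first_index.

Section extension_by_density.
Context d (X : measurableType d) (R : realType).
Variable mu : {measure set X -> \bar R}.
Hypothesis adm : admissible mu.
Variables (L : premodule mu) (N : normed_module mu) (Rel : L -> N -> Prop).
Hypothesis Rlin : forall a v y v' y', Rel v y -> Rel v' y' ->
  Rel (a *: v + v') (a *: y + y').
Hypothesis Rle : forall v y, Rel v y -> \forall x \ae mu, pnorm y x <= pnorm v x.
Variable t : nat -> L * N.
Hypothesis tR : forall i, Rel (t i).1 (t i).2.
Hypothesis tdense : forall v, \forall x \ae mu, forall e, 0 < e ->
  exists i, pnorm (v - (t i).1) x < e.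

(* [cl] is the closure of the graph [Rel] for a.e. pointwise approximation: only
   countably many approximants are allowed, since pointwise values depend on
   representatives. *)
Let cl (v : L) (y : N) := exists (I : countType) (u : I -> L * N),
  (forall i, Rel (u i).1 (u i).2) /\
  \forall x \ae mu, forall e, 0 < e ->
    exists i, pnorm (v - (u i).1) x < e /\ pnorm (y - (u i).2) x < e.

Let linB (M M' : lmodType (L0 mu)) (F : M -> M') : linear F ->
  forall v w, F (v - w) = F v - F w.
Proof. by move=> lF v w; rewrite addrC -scaleN1r lF scaleN1r addrC. Qed.

Let cl_le v y : cl v y -> \forall x \ae mu, pnorm y x <= pnorm v x.
Proof.
move=> [I [u [uR uP]]].
have H1 : \forall x \ae mu, forall i, pnorm (u i).2 x <= pnorm (u i).1 x.
  by apply: ae_forall_count => i; exact/Rle/uR.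
have H2 : \forall x \ae mu, forall i,
    `|pnorm v x - pnorm (u i).1 x| <= pnorm (v - (u i).1) x.
  by apply: ae_forall_count => i; exact: pnorm_dist.
have H3 : \forall x \ae mu, forall i,
    `|pnorm y x - pnorm (u i).2 x| <= pnorm (y - (u i).2) x.
  by apply: ae_forall_count => i; exact: pnorm_dist.
apply: filterS3 uP H1 (filterI H2 H3) => x {}uP {}H1 [{}H2 {}H3].
apply/ler_addgt0Pr => e e0; have [|i [vi yi]] := uP (e / 2).
  by rewrite divr_gt0.
have := H1 i; have := H2 i; have := H3 i; rewrite !ler_distl => /andP[_ a] /andP[b _].
lra.
Qed.

Let cl_lin (a : L0 mu) v y v' y' : cl v y -> cl v' y' -> cl (a *: v + v') (a *: y + y').
Proof.
move=> [I [u [uR uP]]] [I' [u' [uR' uP']]].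
exists (I * I')%type, (fun p => (a *: (u p.1).1 + (u' p.2).1, a *: (u p.1).2 + (u' p.2).2)).
split; first by move=> p; exact: Rlin.
have tri (M : premodule mu) (z z' : M) (w : I -> M) (w' : I' -> M) :
    \forall x \ae mu, forall p : I * I',
    pnorm (a *: z + z' - (a *: w p.1 + w' p.2)) x <=
      `|a x| * pnorm (z - w p.1) x + pnorm (z' - w' p.2) x.
  apply: ae_forall_count => p.
  have := ler_pnormD (a *: (z - w p.1)) (z' - w' p.2).
  rewrite scalerBr addrACA -opprD; apply: filterS2 (pnormZE a (z - w p.1)) => x.
  by rewrite scalerBr => ->.
have H1 := tri _ v v' (fun i => (u i).1) (fun i => (u' i).1).
have H2 := tri _ y y' (fun i => (u i).2) (fun i => (u' i).2).
apply: filterS3 (filterI uP uP') H1 H2 => x [{}uP {}uP'] {}H1 {}H2 e e0.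
(* The added 1 allows division where [a x] vanishes. *)
have a0 : 0 < `|a x| + 1 by rewrite ltr_wpDl.
have [|i [vi yi]] := uP (e / 2 / (`|a x| + 1)); first by rewrite !divr_gt0.
have [|i' [vi' yi']] := uP' (e / 2); first by rewrite divr_gt0.
have key z : 0 <= `|a x| -> z < e / 2 / (`|a x| + 1) -> `|a x| * z <= e / 2.
  rewrite ltr_pdivlMr// => ax ze; have [z0|z0] := ltP 0 z; first by nra.
  apply: (@le_trans _ _ 0); last by rewrite divr_ge0// ltW.
  by rewrite mulr_ge0_le0.
exists (i, i') => /=; split.
  by have := H1 (i, i'); have := key _ (normr_ge0 _) vi; move=> /=; lra.
by have := H2 (i, i'); have := key _ (normr_ge0 _) yi; move=> /=; lra.
Qed.

(** By linearity the difference of the two values is a value over 0, and [cl_le] forces its norm to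
    vanish. *)
Let cl_uniq v y y' : cl v y -> cl v y' -> y = y'.
Proof.
move=> vy vy'; have := cl_le (cl_lin (-1) vy' vy).
rewrite !scaleN1r !addNr => H.
apply: pnorm_ae_eq; rewrite addrC.
apply: filterS3 H (pnorm0E L) (pnorm_ge0 (- y' + y)) => x h h0 hge.
by apply/eqP; rewrite eq_le hge -h0 h.
Qed.

Let cl_Rel v y : Rel v y -> cl v y.
Proof.
move=> vy; exists unit, (fun=> (v, y)); split => //=; rewrite !subrr.
by apply: filterS2 (pnorm0E L) (pnorm0E N) => x -> -> e e0; exists tt.
Qed.

(** At scale [r j], the image of the first [t i] that is [r j]-close to [v] is selected at each
    point, and these images are glued into [y j]. Since [Rel] is contractive, the [y j] form a
    uniformly Cauchy sequence, whose limit is the value sought. *)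
Let cl_exists v : exists y, cl v y.
Proof.
pose r j : R := j.+1%:R^-1.
have r0 j : 0 < r j by rewrite invr_gt0.
have /choice[k kP] j := @first_index _ X (fun i x => pnorm (v - (t i).1) x < r j)
  (fun i => measurable_pnorm_lt (v - (t i).1) (r j)).
pose s (o : option nat) : N := if o is Some i then (t i).2 else 0.
have /choice[y yP] j : exists y, \forall x \ae mu, pnorm (y - s (k j x)) x = 0.
  by have [mk _ _] := kP j; exact: (countable_glue adm s mk).
have {}yP := ae_foralln yP.
have tlip : \forall x \ae mu, forall p : nat * nat,
    pnorm ((t p.1).2 - (t p.2).2) x <= pnorm ((t p.1).1 - (t p.2).1) x.
  apply: ae_forall_count => p; apply: Rle.
  by have := Rlin (-1) (tR p.2) (tR p.1); rewrite !scaleN1r addrC [- _ + _]addrC.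
have ttri : \forall x \ae mu, forall p : nat * nat,
    pnorm ((t p.1).1 - (t p.2).1) x <=
    pnorm (v - (t p.1).1) x + pnorm (v - (t p.2).1) x.
  apply: ae_forall_count => p; rewrite [pnorm (v - (t p.1).1)]pnormB_sym.
  exact: pnorm_triangle.
have yt (z : N) : \forall x \ae mu, forall i j,
    pnorm (z - (t i).2) x <= pnorm (z - y j) x + pnorm (y j - (t i).2) x.
  suff : \forall x \ae mu, forall p : nat * nat, pnorm (z - (t p.1).2) x <=
      pnorm (z - y p.2) x + pnorm (y p.2 - (t p.1).2) x.
    by apply: filterS => x H i j; exact: (H (i, j)).
  by apply: ae_forall_count => p; exact: pnorm_triangle.
have near_t : \forall x \ae mu, forall j, exists i,
    pnorm (v - (t i).1) x < r j /\ pnorm (y j - (t i).2) x = 0.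
  apply: filterS2 (tdense v) yP => x tdx {}yP j.
  have [_ k1 k2] := kP j.
  case kx : (k j x) => [i|]; last first.
    by have [i vi] := tdx (r j) (r0 j); have := k2 _ kx i.
  exists i; split; first by have [] := k1 _ _ kx.
  by have := yP j; rewrite kx.
(* The rate holds at every index, hence the constant 0 for [k]. The factor 2 comes from
   [r i + r j <= 2 * r i] for [i <= j]. *)
have [|||z zP] := @ae_limit _ _ _ _ adm N y (fun=> 0%N) (fun j => 2 * r j).
- by move=> i; rewrite (_ : [set _ | _] = setT) //; exact/seteqP.
- rewrite -[X in _ --> X](mulr0 (2 : R)); apply: cvgMr; exact: cvg_harmonic.
- move=> i j ij.
  have ytty : \forall x \ae mu, forall p : nat * nat, pnorm (y i - y j) x <=
      pnorm (y i - (t p.1).2) x +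
      (pnorm ((t p.1).2 - (t p.2).2) x + pnorm (y j - (t p.2).2) x).
    apply: ae_forall_count => p; rewrite [pnorm (y j - _)]pnormB_sym.
    apply: filterS2 (pnorm_triangle (t p.1).2 (y i) (y j))
      (pnorm_triangle (t p.2).2 (t p.1).2 (y j)) => x; lra.
  apply: filterS3 near_t (filterI tlip ttri) ytty => x near_tx [tlipx ttrix] yttyx _.
  have [a [va ya]] := near_tx i; have [b [vb yb]] := near_tx j.
  have := yttyx (a, b); have := tlipx (a, b); have := ttrix (a, b).
  rewrite /= ya yb addr0 add0r.
  have rij : r j <= r i by rewrite /r lef_pV2 ?posrE ?ltr0n// ler_nat ltnS.
  lra.
exists z; exists nat, t; split => //.
have {}zP := ae_foralln zP.
apply: filterS3 zP near_t (yt z) => x zPx near_tx ytx e e0.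
have [j je] := @inv_succ_lt _ (e / 2) (divr_gt0 e0 (ltr0n _ 2)).
have [i [vi yi]] := near_tx j; exists i; split.
  by rewrite (lt_trans vi)// (lt_trans je)//; lra.
have := zPx j erefl; have := ytx i j; rewrite yi addr0 [pnorm (y j - z)]pnormB_sym.
move=> h1 h2; apply: le_lt_trans h1 _; apply: le_lt_trans h2 _.
by rewrite mulrC -ltr_pdivlMr.
Qed.

(** The partial morphism is given as a relation because an element may come from several stages of a
    direct system. Contractivity makes it single-valued, and its closure [cl] is the graph of the
    extension. *)
Lemma dense_extension : exists! Phi : L -> N,
  is_morphism Phi /\ forall v y, Rel v y -> Phi v = y.
Proof.
have /choice[Phi PhiP] := cl_exists.
exists Phi; split.
  split; last by move=> v y /cl_Rel; exact: cl_uniq.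
  split; last by move=> v; exact/cl_le.
  move=> a v w; apply: cl_uniq (PhiP _) _; exact: cl_lin.
move=> Psi [[Plin Ple] PR]; apply/funext => v; apply: cl_uniq (PhiP v) _.
(* Contractivity of [Psi] makes [(v, Psi v)] a point of the closure, approximated along [t]. *)
exists nat, t; split => //.
have H : \forall x \ae mu, forall i,
    pnorm (Psi v - (t i).2) x <= pnorm (v - (t i).1) x.
  by apply: ae_foralln => i; rewrite -(PR _ _ (tR i)) -linB//; exact: Ple.
apply: filterS2 (tdense v) H => x tdx {}H e /tdx[i vi].
by exists i; split => //; exact: le_lt_trans vi.
Qed.

End extension_by_density.

(** * Sigma-finiteness and separability *)

Section sigma_finite_admissible.
Context d (X : measurableType d) (R : realType).

(** The probability is the normalisation of a weighted sum of the restrictions of [mu] to the sets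
    [F i] of finite measure. *)
Lemma admissible_sigma_finite (mu : {measure set X -> \bar R}) :
  sigma_finite setT mu -> admissible mu.
Proof.
move=> [F FT mF].
have [mu0|mu0] := eqVneq (mu setT) 0%E; [by left|right].
have [x _] : [set: X] !=set0.
  by apply/set0P/eqP => X0; move: mu0; rewrite X0 measure0 eqxx.
have fF i : mu (F i) \is a fin_num by rewrite ge0_fin_numE//; exact: (mF i).2.
(* The powers of 2 bound the total mass by 1; the term 1 in the last factor avoids dividing by a
   null mass. *)
pose c i : R := 1 / (2 ^ i.+1)%:R / (1 + fine (mu (F i))).
have c0 i : 0 < c i.
  by rewrite !divr_gt0// ?ltr0n ?expn_gt0// ltr_pwDl// fine_ge0.
pose nu := mseries (fun i => mscale (NngNum (ltW (c0 i))) (mrestr mu (mF i).1)) 0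
  : {measure set X -> \bar R}.
have nuE A : nu A = (\sum_(0 <= i <oo) (c i)%:E * mu (A `&` F i))%E by [].
have nu_mu A : measurable A -> nu A = 0%E <-> mu A = 0%E.
  move=> mA; split=> A0.
    have AF i : mu (A `&` F i) = 0%E.
      have : ((c i)%:E * mu (A `&` F i) <= nu A)%E.
        rewrite nuE (@nneseriesD1 _ _ i)//; last first.
          by move=> k _; rewrite mule_ge0// lee_fin ltW.
        by rewrite leeDl// nneseries_ge0// => k _ _; rewrite mule_ge0// lee_fin ltW.
      rewrite A0 pmule_rle0 ?lte_fin// => H.
      by apply/eqP; rewrite eq_le H measure_ge0.
    rewrite -[A]setIT FT setI_bigcupr.
    have mAF k : measurable (A `&` F k) by apply: measurableI => //; exact: (mF k).1.
    apply: measure_negligible; first exact: bigcup_measurable.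
    by apply: negligible_bigcup => k; exists (A `&` F k); split.
  rewrite nuE eseries0// => i _ _.
  rewrite (subset_measure0 _ mA) ?mule0//.
  by apply: measurableI => //; exact: (mF i).1.
have nu_lty : (nu setT < +oo)%E.
  apply: (@le_lt_trans _ _ 1%E); last exact: ltry.
  apply: le_trans (epsilon_trick0 xpredT (@ler01 R)).
  rewrite nuE; apply: lee_nneseries => i _.
    by rewrite mule_ge0// lee_fin ltW.
  rewrite setTI -(fineK (fF i)) -EFinM lee_fin /c.
  rewrite -[leLHS]mulrA ler_piMr ?divr_ge0// mulrC ler_pdivrMr ?mul1r ?lerDr//.
have nu_neq0 : nu setT != 0%E by apply: contra mu0 => /eqP/(nu_mu _ measurableT)/eqP.
(* The Dirac mass is the default of [mnormalize] for zero or infinite total mass, cases excluded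
   here. *)
pose P : probability X R := mnormalize nu (\d_x).
have PE A : P A = (nu A * (fine (nu setT))^-1%:E)%E.
  by rewrite /P/= /mnormalize (negbTE nu_neq0) (lt_eqF nu_lty).
exists P; split; apply/null_content_dominatesP => A mA.
  move=> PA0; have /esym/eqP := etrans (esym PA0) (PE A).
  rewrite mule_eq0 => /orP[/eqP/(nu_mu A mA)//|].
  rewrite eqe invr_eq0 fine_eq0 ?(negbTE nu_neq0)//.
  by rewrite ge0_fin_numE.
by move/(nu_mu A mA) => A0; apply: etrans (PE A) _; rewrite A0 mul0e.
Qed.

Lemma sigma_finite_mrestr (mu : {measure set X -> \bar R}) (A : set X)
  (mA : measurable A) : sigma_finite setT mu -> sigma_finite setT (mrestr mu mA).
Proof.
move=> [F FT mF]; exists F => // i; split; first exact: (mF i).1.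
apply: le_lt_trans (mF i).2; apply: le_measure; rewrite ?inE//.
- by apply: measurableI => //; exact: (mF i).1.
- exact: (mF i).1.
Qed.

End sigma_finite_admissible.

Section separability_ae.
Context d (X : measurableType d) (R : realType).
Variable mu : {measure set X -> \bar R}.
Hypothesis adm : admissible mu.

Lemma separable_ae_dense (M : premodule mu) : separable_module M ->
  exists w : nat -> M, forall v, \forall x \ae mu, forall e, 0 < e ->
    exists i, pnorm (v - w i) x < e.
Proof.
case: adm => [mu0 _|[P [muP Pmu]] sepM].
  by exists (fun=> 0) => v; exact: ae_trivial.
have [D [/countable_injP[f fI] D_dense]] := sepM P muP Pmu.
have [w wP] : exists w : nat -> M, forall v, D v -> exists i, w i = v.
  (* Indices outside the image of the injection [f] enumerate 0, which does not spoil density. *)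
  exists (fun n => xget 0 [set v | D v /\ f v = n]) => v Dv; exists (f v).
  case: xgetP => [u _ [Du fu]|/(_ v) []//].
  by apply: fI => //; rewrite inE.
exists w => v; apply: (ae_close muP Pmu) => e e0.
by have [_ /wP[i <-] ?] := D_dense v e e0; exists i.
Qed.

End separability_ae.

(** * Restriction of a module to a measurable set *)

Section L0_extension.
Context d (X : measurableType d) (R : realType).
Variables (m : {measure set X -> \bar R}) (A : set X) (mA : measurable A).
Local Notation mu := (mrestr m mA).
Implicit Types f g : L0 mu.

Lemma L0_ext_in f : \forall x \ae m, A x -> L0_ext f x = f x.
Proof. by apply: filterS (L0_extE f) => x -> Ax; rewrite patchE mem_set. Qed.

Lemma L0_ext_out f : \forall x \ae m, ~ A x -> L0_ext f x = 0.
Proof. by apply: filterS (L0_extE f) => x -> Ax; rewrite patchE memNset. Qed.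

Lemma L0_ext_uniq f (g : L0 m) :
  (\forall x \ae m, A x -> g x = f x) -> (\forall x \ae m, ~ A x -> g x = 0) ->
  g = L0_ext f.
Proof.
move=> gin gout; apply: L0P.
apply: filterS2 (filterI gin gout) (filterI (L0_ext_in f) (L0_ext_out f)).
move=> x [xin xout] [xin' xout'].
by have [Ax|Ax] := pselect (A x); [rewrite xin// xin'|rewrite xout// xout'].
Qed.

Lemma L0_extD f g : L0_ext (f + g) = L0_ext f + L0_ext g.
Proof.
apply: esym; apply: L0_ext_uniq.
  have /(ae_mrestr m mA) H := L0_DE f g.
  apply: filterS3 H (L0_DE (L0_ext f) (L0_ext g))
    (filterI (L0_ext_in f) (L0_ext_in g)) => x H -> [Hf Hg] Ax.
  by rewrite H// Hf// Hg.
apply: filterS3 (L0_DE (L0_ext f) (L0_ext g)) (L0_ext_out f) (L0_ext_out g).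
by move=> x -> Hf Hg Ax; rewrite Hf// Hg// addr0.
Qed.

Lemma L0_extM f g : L0_ext (f * g) = L0_ext f * L0_ext g.
Proof.
apply: esym; apply: L0_ext_uniq.
  have /(ae_mrestr m mA) H := L0_ME f g.
  apply: filterS3 H (L0_ME (L0_ext f) (L0_ext g))
    (filterI (L0_ext_in f) (L0_ext_in g)) => x H -> [Hf Hg] Ax.
  by rewrite H// Hf// Hg.
apply: filterS2 (L0_ME (L0_ext f) (L0_ext g)) (L0_ext_out f).
by move=> x -> Hf Ax; rewrite Hf// mul0r.
Qed.

Lemma L0_ext_res (g : L0 m) : L0_ext (L0_res mA g) = L0_ext (1 : L0 mu) * g.
Proof.
have /(ae_mrestr m mA) H1 := L0_1E mu.
apply: esym; apply: L0_ext_uniq.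
  apply: filterS3 H1 (L0_ME (L0_ext (1 : L0 mu)) g)
    (filterI (L0_ext_in (1 : L0 mu)) (L0_resE mA g)) => x {}H1 -> [Hf Hg] Ax.
  by rewrite Hf// Hg// H1// mul1r.
apply: filterS2 (L0_ME (L0_ext (1 : L0 mu)) g) (L0_ext_out (1 : L0 mu)).
by move=> x -> Hf Ax; rewrite Hf// mul0r.
Qed.

Lemma L0_ext1E : \forall x \ae m, L0_ext (1 : L0 mu) x = \1_A x.
Proof.
have /(ae_mrestr m mA) H1 := L0_1E mu.
apply: filterS3 H1 (L0_ext_in (1 : L0 mu)) (L0_ext_out (1 : L0 mu)) => x H1 Hin Hout.
have [Ax|Ax] := pselect (A x); rewrite indicE.
  by rewrite mem_set// Hin// H1.
by rewrite memNset// Hout.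
Qed.

End L0_extension.

Section restricted_module.
Context d (X : measurableType d) (R : realType).
Variables (m : {measure set X -> \bar R}) (A : set X) (mA : measurable A).
Variable M : normed_module m.
Local Notation mu := (mrestr m mA).
Local Notation chi := (L0_ext (1 : L0 mu)).

(* [chi_A M], realised as the elements of [M] fixed by [chi_A]. *)
Definition rest_pred : {pred M} := fun v => chi *: v == v.

Let rest_zmod : zmod_closed rest_pred.
Proof.
split; first by rewrite unfold_in scaler0.
by move=> u v; rewrite !unfold_in scalerBr => /eqP -> /eqP ->.
Qed.

HB.instance Definition _ := GRing.isZmodClosed.Build M rest_pred rest_zmod.

Record rest := Rest { rest_val : M ; restP : rest_val \in rest_pred }.

HB.instance Definition _ := [isSub for rest_val].
HB.instance Definition _ := [Choice of rest by <:].
HB.instance Definition _ := [SubChoice_isSubZmodule of rest by <:].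

Lemma rest_ext (f : L0 mu) (v : M) : L0_ext f *: v \in rest_pred.
Proof. by rewrite unfold_in scalerA -L0_extM mul1r. Qed.

Lemma rest_chi (v : rest) : chi *: rest_val v = rest_val v.
Proof. by apply/eqP; have := restP v; rewrite unfold_in. Qed.

Definition rest_scale (f : L0 mu) (v : rest) : rest := Rest (rest_ext f (rest_val v)).

Let scaleA f g v : rest_scale f (rest_scale g v) = rest_scale (f * g) v.
Proof. by apply: val_inj; rewrite /= scalerA L0_extM. Qed.
Let scale1 : left_id 1 rest_scale.
Proof. by move=> v; apply: val_inj; rewrite /= rest_chi. Qed.
Let scaleDr : right_distributive rest_scale +%R.
Proof. by move=> f u v; apply: val_inj; exact: scalerDr. Qed.
Let scaleDl v : {morph rest_scale^~ v : f g / f + g}.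
Proof. by move=> f g; apply: val_inj; rewrite /= L0_extD; exact: scalerDl. Qed.

HB.instance Definition _ := GRing.Zmodule_isLmodule.Build (L0 mu) rest
  scaleA scale1 scaleDr scaleDl.

Definition rest_norm (v : rest) : L0 mu := L0_res mA (pnorm (rest_val v)).

Lemma rest_normE v : \forall x \ae m, A x -> rest_norm v x = pnorm (rest_val v) x.
Proof. exact: L0_resE. Qed.

Lemma rest_norm_out (v : rest) : \forall x \ae m, ~ A x -> pnorm (rest_val v) x = 0.
Proof.
have H := pnormZE chi (rest_val v); rewrite rest_chi in H.
apply: filterS2 H (L0_ext_out (1 : L0 mu)) => x -> Hout Ax.
by rewrite Hout// normr0 mul0r.
Qed.

Let norm_ge0 v : \forall x \ae mu, 0 <= rest_norm v x.
Proof.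
apply/ae_mrestr; apply: filterS2 (rest_normE v) (pnorm_ge0 (rest_val v)).
by move=> x H ? Ax; rewrite H.
Qed.

Let norm_eq0 v : rest_norm v = 0 <-> v = 0.
Proof.
have /(ae_mrestr m mA) H0 := L0_0E mu.
split=> [v0|->].
  apply: val_inj; apply: pnorm_ae_eq0.
  have H := rest_normE v; rewrite v0 in H.
  apply: filterS3 H0 H (rest_norm_out v) => x Hx0 Hin Hout.
  by have [Ax|Ax] := pselect (A x); [rewrite -Hin// Hx0|rewrite Hout].
apply: L0P; apply/ae_mrestr.
apply: filterS3 H0 (rest_normE 0) (pnorm0E M) => x Hx0 Hin H Ax.
by rewrite Hin// Hx0.
Qed.

Let normD v w : \forall x \ae mu, rest_norm (v + w) x <= rest_norm v x + rest_norm w x.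
Proof.
apply/ae_mrestr; apply: filterS3 (rest_normE (v + w))
  (filterI (rest_normE v) (rest_normE w)) (ler_pnormD (rest_val v) (rest_val w)).
by move=> x H1 [H2 H3] H4 Ax; rewrite H1// H2// H3.
Qed.

Let normZ f v : rest_norm (f *: v) = L0_abs f * rest_norm v.
Proof.
apply: L0P; apply/ae_mrestr.
have /(ae_mrestr m mA) H1 := L0_ME (L0_abs f) (rest_norm v).
have /(ae_mrestr m mA) H2 := L0_absE f.
apply: filterS3 (filterI H1 H2) (filterI (rest_normE (f *: v)) (rest_normE v))
  (filterI (pnormZE (L0_ext f) (rest_val v)) (L0_ext_in f)).
move=> x [{}H1 {}H2] [H3 H4] [H5 H6] Ax.
by rewrite H1// H2// H3// H4// H5 H6.
Qed.

Definition rest_premodule : premodule mu := @Premodule _ _ _ mu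
  rest rest_norm norm_ge0 norm_eq0 normD normZ.

End restricted_module.

(** * Completeness of the restricted module *)

Section restricted_completeness.
Context d (X : measurableType d) (R : realType).
Variables (m : {measure set X -> \bar R}) (A : set X) (mA : measurable A).
Hypothesis adm : admissible m.
Variable M : normed_module m.
Local Notation mu := (mrestr m mA).
Local Notation MA := (rest_premodule mA M).

Section extended_probability.
Variable P : probability X R.
Hypotheses (muP : mu `<< P) (Pmu : P `<< mu).

(* [P'] is the normalised sum of [P], which lives on [A], and of an admissible
   probability restricted to the complement of [A]: the latter does not see
   elements supported in [A]. *)
Lemma extend_probability : exists (c : R) (P' : probability X R),
  [/\ 0 < c, m `<< P', P' `<< m &
    forall v w : MA, pdist P' (rest_val v) (rest_val w) = c * pdist P v w].
Proof.
have /null_content_dominatesP muP' := muP.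
have /null_content_dominatesP Pmu' := Pmu.
case: adm => [m0|[Q [mQ Qm]]].
  (* If [m] vanished, [P] would vanish by domination, against its total mass 1. *)
  have : P setT = 0%E.
    by apply: Pmu' => //; apply: (subset_measure0 _ _ _ m0); rewrite ?setTI.
  by rewrite probability_setT => /eqP; rewrite onee_eq0.
have Qdom := Qm.
move/null_content_dominatesP : mQ => mQ; move/null_content_dominatesP : Qm => Qm.
pose rho := measure_add P (mrestr Q (measurableC mA)) : {measure set X -> \bar R}.
have rhoE B : rho B = (P B + Q (B `&` ~` A))%E by exact: measure_addE.
have rho1 : (1 <= rho setT)%E.
  by rewrite rhoE; have := @probability_setT _ _ _ P => ->; rewrite leeDl.
have mCA B : measurable B -> measurable (B `&` ~` A).
  by move=> mB; apply: measurableI => //; exact: measurableC.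
have rho_fin : rho setT \is a fin_num.
  by rewrite rhoE fin_numD !fin_num_measure//; exact: mCA.
pose P' : probability X R := mnormalize rho P.
have rho0 : rho setT != 0%E by rewrite gt_eqF// (lt_le_trans _ rho1).
pose r := fine (rho setT).
have r0 : 0 < r by rewrite fine_gt0// (lt_le_trans _ rho1)//= ltey_eq rho_fin.
have P'E B : P' B = (rho B * (r^-1)%:E)%E.
  by rewrite /P'/= /mnormalize (negbTE rho0)/= lt_eqF// ltey_eq rho_fin.
have P'm : P' `<< m.
  apply/null_content_dominatesP => B mB B0; apply: etrans (P'E B) _.
  have -> : rho B = 0%E; last by rewrite mul0e.
  rewrite rhoE (_ : P B = 0%E) ?add0e.
    by apply: Qm; [exact: mCA|apply: (subset_measure0 _ mB _ B0) => //; exact: mCA].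
  apply: Pmu' => //; apply: (subset_measure0 _ mB _ B0) => //.
  exact: measurableI.
exists r^-1, P'; split; first by rewrite invr_gt0.
- apply/null_content_dominatesP => B mB B0.
  have /eqP := etrans (esym (P'E B)) B0.
  rewrite mule_eq0 eqe invr_eq0 (gt_eqF r0) orbF rhoE => /eqP rB0.
  have PB : P B = 0%E.
    by apply/eqP; rewrite eq_le measure_ge0 andbT -rB0 leeDl.
  have QB : Q (B `&` ~` A) = 0%E.
    by apply/eqP; rewrite eq_le measure_ge0 andbT -rB0 leeDr.
  have n1 : m.-negligible (B `&` ~` A).
    by exists (B `&` ~` A); split => //; [exact: mCA|exact: mQ (mCA _ mB) QB].
  have n2 : m.-negligible (B `&` A).
    by exists (B `&` A); split => //; [exact: measurableI|exact: (muP' _ mB PB)].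
  apply: measure_negligible => //; apply: negligibleS (negligibleU n1 n2) => x Bx.
  by have [Ax|Ax] := pselect (A x); [right|left].
- exact: P'm.
- move=> v w; apply: EFin_inj; rewrite EFinM !pdistE//.
  rewrite -[rest_val v - rest_val w]/(rest_val (v - w)); set z : rest _ _ := v - w.
  have mt : measurable_fun setT (EFin \o tnorm (rest_val z)).
    by apply/measurable_EFinP; exact: tnorm_measurable.
  have t0 x : setT x -> (0 <= (tnorm (rest_val z) x)%:E)%E.
    by move=> _; rewrite lee_fin tnorm_ge0.
  have r10 : 0 <= r^-1 by rewrite invr_ge0 ltW.
  rewrite (eq_measure_integral (mscale (NngNum r10) rho)); last first.
    by move=> B mB _; rewrite [LHS]P'E muleC.
  rewrite ge0_integral_mscale//= ge0_integral_measure_add//.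
  (* The contribution of the complement of [A] is zero, since elements of the restricted module have
     zero norm there. *)
  rewrite [X in (_ + X)%E](_ : _ = 0%E) ?adde0; last first.
    rewrite -[RHS](integral0 (mrestr Q (measurableC mA)) setT).
    apply: ae_eq_integral => //.
    apply/(ae_mrestr Q (measurableC mA)).
    apply: filterS (ae_dominated Qdom (rest_norm_out z)) => x H Ax _.
    by rewrite /tnorm H// normr0 min_l.
  congr (_ * _)%E; apply: ae_eq_integral => //.
    by apply/measurable_EFinP; exact: tnorm_measurable.
  have H : \forall x \ae mu, rest_norm z x = pnorm (rest_val z) x.
    by apply/ae_mrestr; exact: rest_normE.
  by apply: filterS (ae_dominated Pmu H) => x Hx _; rewrite /= /tnorm -Hx.
Qed.

End extended_probability.

(** The sequence is Cauchy in [M] for the extended probability. Its limit [v] is projected to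
    [chi_A v], and this does not increase the distance to the [u i], which are fixed by [chi_A]. *)
Lemma rest_complete : pcomplete MA.
Proof.
move=> P muP Pmu u ucauchy.
have [c [P' [c0 mP' P'm dP']]] := extend_probability muP Pmu.
have [e e0|v uv] := @nm_complete _ _ _ _ M P' mP' P'm (fun i => rest_val (u i)).
  have [N HN] := ucauchy (e / c) (divr_gt0 e0 c0); exists N => i j Ni Nj.
  by rewrite dP' mulrC -ltr_pdivlMr// HN.
exists (Rest (rest_ext 1 v)).
have dle i : pdist P (u i) (Rest (rest_ext 1 v)) <= c^-1 * pdist P' (rest_val (u i)) v.
  rewrite mulrC ler_pdivlMr// mulrC -dP'; apply: pdist_le => //.
  have H := pnormZE (L0_ext (1 : L0 mu)) (rest_val (u i) - v).
  rewrite scalerBr rest_chi in H.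
  have H1 := @L0_ext1E _ _ _ m _ mA; have H0 := pnorm_ge0 (rest_val (u i) - v).
  apply: filterS3 H H1 H0 => x /= -> -> x0.
  by rewrite ler_piMl// indicE; case: (_ \in _); rewrite ?normr1 ?normr0.
apply: (@squeeze_cvgr _ _ _ _ (fun=> 0) (fun i => c^-1 * pdist P' (rest_val (u i)) v)).
- apply: nearW => i; rewrite dle andbT; apply: fine_ge0.
  by apply: integral_ge0 => x _; rewrite lee_fin le_min normr_ge0 ler01.
- exact: cvg_cst.
- by rewrite -[X in _ --> X](mulr0 c^-1); apply: cvgMr.
Qed.

Definition rest_module : normed_module mu := Defs.NormedModule rest_complete.

End restricted_completeness.

(** * Selection of a pointwise basis *)

Section constant_classes.
Context d (X : measurableType d) (R : realType).
Variable mu : {measure set X -> \bar R}.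

Definition L0_cst (r : R) : L0 mu := ae_class mu (measurable_cst r).

Lemma L0_cstE r : \forall x \ae mu, L0_cst r x = r.
Proof. exact: ae_class_repr. Qed.

Lemma L0_cst0 : L0_cst 0 = 0. Proof. by []. Qed.
Lemma L0_cst1 : L0_cst 1 = 1. Proof. by []. Qed.

Lemma L0_cstD r s : L0_cst (r + s) = L0_cst r + L0_cst s.
Proof.
apply: L0P; apply: filterS3 (L0_cstE (r + s)) (L0_DE (L0_cst r) (L0_cst s))
  (filterI (L0_cstE r) (L0_cstE s)) => x -> -> [-> ->].
by [].
Qed.

Lemma L0_cstM r s : L0_cst (r * s) = L0_cst r * L0_cst s.
Proof.
apply: L0P; apply: filterS3 (L0_cstE (r * s)) (L0_ME (L0_cst r) (L0_cst s))
  (filterI (L0_cstE r) (L0_cstE s)) => x -> -> [-> ->].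
by [].
Qed.

End constant_classes.

Section combinations.
Context d (X : measurableType d) (R : realType).
Variables (mu : {measure set X -> \bar R}) (M : premodule mu).
Implicit Types (v : nat -> M) (f g : nat -> L0 mu) (p q : {poly rat}).

Definition lcomb v l f : M := \sum_(j < l) f j *: v j.

(** Polynomials encode finite families of rational coefficients: they form a countable type with
    linear operations and truncation. Coefficients of index at least [l] are ignored. *)
Definition qcomb v l q : M := lcomb v l (fun j => L0_cst mu (ratr q`_j)).

Lemma lcombB v l f g : lcomb v l f - lcomb v l g = lcomb v l (fun j => f j - g j).
Proof. by rewrite /lcomb -sumrB; apply: eq_bigr => j _; rewrite scalerBl. Qed.

Lemma pnorm_lcomb v l f : \forall x \ae mu,
  pnorm (lcomb v l f) x <= \sum_(j < l) `|f j x| * pnorm (v j) x.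
Proof.
have H : \forall x \ae mu, forall j, pnorm (f j *: v j) x = `|f j x| * pnorm (v j) x.
  by apply: ae_foralln => j; exact: pnormZE.
apply: filterS2 H (pnorm_sum l (fun j => f j *: v j)) => x H.
by under [in leRHS]eq_bigr do rewrite H.
Qed.

Lemma qcombS v l q : qcomb v l.+1 q = qcomb v l q + L0_cst mu (ratr q`_l) *: v l.
Proof. exact: big_ord_recr. Qed.

Lemma qcombD v l p q : qcomb v l (p + q) = qcomb v l p + qcomb v l q.
Proof.
rewrite /qcomb /lcomb -big_split; apply: eq_bigr => j _ /=.
by rewrite coefD rmorphD/= L0_cstD scalerDl.
Qed.

Lemma qcombZ v l (r : rat) q : qcomb v l (r *: q) = L0_cst mu (ratr r) *: qcomb v l q.
Proof.
rewrite /qcomb /lcomb scaler_sumr; apply: eq_bigr => j _ /=.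
by rewrite coefZ rmorphM/= L0_cstM scalerA.
Qed.

Lemma qcombN v l q : qcomb v l (- q) = - qcomb v l q.
Proof.
apply/eqP; rewrite -addr_eq0 -qcombD addNr -(scale0r (0 : {poly rat})).
by rewrite qcombZ rmorph0 L0_cst0 scale0r.
Qed.

Lemma eq_qcomb v v' l p q : (forall j, (j < l)%N -> v j = v' j) ->
  (forall j, (j < l)%N -> p`_j = q`_j) -> qcomb v l p = qcomb v' l q.
Proof.
move=> vv' pq; rewrite /qcomb /lcomb; apply: eq_bigr => j _.
by rewrite vv'// pq.
Qed.

Lemma qcomb_take v l q : qcomb v l.+1 (take_poly l q) = qcomb v l q.
Proof.
rewrite qcombS coef_take_poly ltnn rmorph0 L0_cst0 scale0r addr0.
by apply: eq_qcomb => // j jl; rewrite coef_take_poly jl.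
Qed.

Lemma qcombX v l : qcomb v l.+1 'X^l = v l.
Proof.
rewrite qcombS coefXn eqxx rmorph1 L0_cst1 scale1r [qcomb _ _ _]big1 ?add0r//.
by move=> j _; rewrite coefXn ltn_eqF// rmorph0 L0_cst0 scale0r.
Qed.

(* [u] is, at [x], in the closure of the rational span of the [v j], [j < l]. *)
Definition in_qspan v l (u : M) (x : X) :=
  forall n : nat, exists q, pnorm (u - qcomb v l q) x < n.+1%:R^-1.

Lemma in_qspan_eps v l u x : in_qspan v l u x ->
  forall e : R, 0 < e -> exists q, pnorm (u - qcomb v l q) x < e.
Proof.
move=> H e /inv_succ_lt[n ne]; have [q uq] := H n.
by exists q; exact: lt_trans ne.
Qed.

Lemma measurable_in_qspan v l u : measurable [set x | in_qspan v l u x].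
Proof.
apply: measurable_forall => n; apply: measurable_exists => q.
exact: measurable_pnorm_lt.
Qed.

Lemma eq_in_qspan v v' l u x : (forall j, (j < l)%N -> v j = v' j) ->
  in_qspan v l u x -> in_qspan v' l u x.
Proof.
move=> vv' H n; have [q uq] := H n; exists q.
by rewrite -(@eq_qcomb v _ _ q q).
Qed.

Lemma in_qspanS v l u x : in_qspan v l u x -> in_qspan v l.+1 u x.
Proof.
by move=> H n; have [q uq] := H n; exists (take_poly l q); rewrite qcomb_take.
Qed.

Lemma in_qspan_ae v l u u' : \forall x \ae mu,
  pnorm (u - u') x = 0 -> in_qspan v l u x -> in_qspan v l u' x.
Proof.
have H : \forall x \ae mu, forall q,
    pnorm (u' - qcomb v l q) x <= pnorm (u - u') x + pnorm (u - qcomb v l q) x.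
  by apply: ae_forall_count => q; rewrite [pnorm (u - u')]pnormB_sym; exact: pnorm_triangle.
apply: filterS H => x H uu' uv n; have [q uq] := uv n; exists q.
by apply: le_lt_trans (H q) _; rewrite uu' add0r.
Qed.

End combinations.

Section pointwise_basis.
Context d (X : measurableType d) (R : realType).
Variable mu : {measure set X -> \bar R}.
Hypothesis adm : admissible mu.
Variables (M : normed_module mu) (w : nat -> M).

(** One step of the selection: [p.2] agrees at [x] with the first [w i] outside the closed span of
    the vectors already chosen, and [p.1] is the set where such an [i] exists. *)
Let next (v : nat -> M) (l : nat) : exists p : set X * M, measurable p.1 /\
  \forall x \ae mu,
    (~ p.1 x -> forall i, in_qspan v l (w i) x) /\
    (p.1 x -> exists i, [/\ ~ in_qspan v l (w i) x,
      forall j, (j < i)%N -> in_qspan v l (w j) x & pnorm (p.2 - w i) x = 0]).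
Proof.
have [k [mk k1 k2]] := @first_index _ X (fun i x => ~ in_qspan v l (w i) x)
  (fun i => measurable_not (measurable_in_qspan v l (w i))).
have [u uP] := countable_glue adm (fun o => if o is Some i then w i else 0) mk.
exists ([set x | k x <> None], u) => /=; split; first exact/measurable_not.
apply: filterS uP => x ux; split.
  by move=> /contrapT kx i; apply: contrapT; exact: (k2 x kx).
case kx : (k x) => [i|//] _; exists i.
have [ni nj] := k1 _ _ kx; split => //; last by rewrite kx in ux.
by move=> j /nj; exact: contrapT.
Qed.

(** Iteration of [next]. The last clause makes the [v l] exhaust the sequence [w] even where the
    selection never stops, that is, in infinite dimension. *)
Lemma pointwise_basis : exists (S : nat -> set X) (v : nat -> M),
  (forall l, measurable (S l)) /\
  \forall x \ae mu, forall l,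
    [/\ S l x -> ~ in_qspan v l (v l) x,
        ~ S l x -> forall i, in_qspan v l (w i) x &
        forall i, (i < l)%N -> in_qspan v l (w i) x].
Proof.
have /choice[F FP] : forall s : seq M, _ := fun s => next (nth 0 s) (size s).
(* Each choice depends on all the earlier ones, so the recursion carries the list of [v 0], ...,
   [v (l - 1)]. *)
pose vs := fix vs (l : nat) : seq M :=
  if l is l'.+1 then rcons (vs l') (F (vs l')).2 else [::].
pose v l := (F (vs l)).2; pose S l := (F (vs l)).1.
have vs_size l : size (vs l) = l by elim: l => //= l IHl; rewrite size_rcons IHl.
have vs_nth l j : (j < l)%N -> nth 0 (vs l) j = v j.
  elim: l => // l IHl; rewrite ltnS leq_eqVlt => /orP[/eqP ->|jl] /=.
    by rewrite nth_rcons vs_size ltnn eqxx.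
  by rewrite nth_rcons vs_size jl IHl.
have spanE l u x : in_qspan (nth 0 (vs l)) (size (vs l)) u x <-> in_qspan v l u x.
  rewrite vs_size; split; apply: eq_in_qspan => j jl; first exact: vs_nth.
  by rewrite vs_nth.
exists S, v; split; first by move=> l; have [] := FP (vs l).
have H1 : \forall x \ae mu, forall l,
    (~ S l x -> forall i, in_qspan v l (w i) x) /\
    (S l x -> exists i, [/\ ~ in_qspan v l (w i) x,
      forall j, (j < i)%N -> in_qspan v l (w j) x & pnorm (v l - w i) x = 0]).
  apply: ae_foralln => l; have [_] := FP (vs l); apply: filterS => x [h1 h2].
  split=> [/h1 h i|/h2[i [hi hj vi]]]; first exact/spanE.
  by exists i; split => //; [move/spanE|move=> j /hj/spanE].
have H2 : \forall x \ae mu, forall l i,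
    pnorm (v l - w i) x = 0 -> in_qspan v l (v l) x -> in_qspan v l (w i) x.
  by apply: ae_foralln => l; apply: ae_foralln => i; exact: in_qspan_ae.
have H3 : \forall x \ae mu, forall i l, pnorm (v l - w i) x = pnorm (w i - v l) x.
  by apply: aeW => x i l; rewrite pnormB_sym.
apply: filterS3 H1 H2 H3 => x {}H1 {}H2 H3.
(* If [S l] holds at [x], then [v l] is the first [w i0] outside the closed span;
   by induction [i0 >= l], so [w l] is [v l] or was already in the span. *)
have third l : forall i, (i < l)%N -> in_qspan v l (w i) x.
  elim: l => // l IHl i; rewrite ltnS leq_eqVlt => /orP[/eqP ->|/IHl/in_qspanS//].
  have [Sl|nSl] := pselect (S l x); last exact/in_qspanS/(H1 l).1.
  have [i0 [hi hj vi]] := (H1 l).2 Sl.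
  have [li|il|li0] := ltngtP l i0; first exact/in_qspanS/hj.
    by have := IHl _ il.
  by move=> n; exists 'X^l; rewrite qcombX -H3 [w l](congr1 w li0) vi invr_gt0.
move=> l; split; [|exact: (H1 l).1|exact: third].
move=> Sl vl; have [i [hi _ vi]] := (H1 l).2 Sl; exact/hi/H2.
Qed.

End pointwise_basis.

(** * From rational to real coefficients *)

Section seminorm_extension.
Variables (R : realType) (p : nat -> {poly rat} -> R) (N : nat -> R).
Implicit Types (a b : nat -> R) (q : {poly rat}) (l : nat).

(** The data seen at one point: [p l] is a seminorm on the rational combinations of the first [l]
    generators, and [N j] plays the norm of the generator of index [j]. The last field makes the
    [p l] compatible with padding by zero. *)
Record qseminorm := QSeminorm {
  qs_N : forall j, 0 <= N j;
  qs_ge0 : forall l q, 0 <= p l q;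
  qs_D : forall l q q', p l (q + q') <= p l q + p l q';
  qs_Z : forall l (r : rat) q, p l (r *: q) = `|ratr r| * p l q;
  qs_le : forall l q, p l q <= \sum_(j < l) `|ratr q`_j| * N j;
  qs_take : forall l q, p l.+1 (take_poly l q) = p l q }.

Definition rcoef q : nat -> R := fun j => ratr q`_j.

(** A weighted l1 pseudodistance, for which every [p l] is 1-Lipschitz. *)
Definition wdist l a b : R := \sum_(j < l) `|a j - b j| * N j.

(* A countable infimum, hence measurable in all data; [rnorm_lip] characterises it
   as the continuous extension of [p l]. *)
Definition rnorm l a : R := inf (range (fun q => p l q + wdist l a (rcoef q))).

Hypothesis hp : qseminorm.

Lemma wdist_ge0 l a b : 0 <= wdist l a b.
Proof. by apply: sumr_ge0 => j _; rewrite mulr_ge0//; exact: qs_N. Qed.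

Lemma wdist_sym l a b : wdist l a b = wdist l b a.
Proof. by apply: eq_bigr => j _; rewrite distrC. Qed.

Lemma wdist_triangle l b a c : wdist l a c <= wdist l a b + wdist l b c.
Proof.
rewrite -big_split; apply: ler_sum => j _ /=.
by rewrite -mulrDl ler_wpM2r ?ler_distD//; exact: qs_N.
Qed.

Lemma wdist_dense l a e : 0 < e -> exists q, wdist l a (rcoef q) < e.
Proof.
(* The 1 keeps [C] positive and the final inequality strict even if all weights vanish. *)
move=> e0; pose C := 1 + \sum_(j < l) N j.
have C0 : 0 < C by rewrite ltr_pwDl// sumr_ge0// => j _; exact: qs_N.
have /choice[r rP] j : exists r : rat, `|a j - ratr r| < e / C.
  by apply: ratr_dense; rewrite divr_gt0.
exists (\poly_(j < l) r j).
apply: (@le_lt_trans _ _ (\sum_(j < l) e / C * N j)).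
  apply: ler_sum => j _; rewrite ler_wpM2r//; first exact: qs_N.
  by rewrite /rcoef coef_poly ltn_ord ltW.
rewrite -mulr_sumr mulrAC ltr_pdivrMr// ltr_pM2l//.
by rewrite /C ltrDr.
Qed.

Lemma qnorm_lip l q q' : p l q <= p l q' + wdist l (rcoef q) (rcoef q').
Proof.
have h := qs_D hp l q' (q - q'); rewrite addrC subrK in h.
apply: le_trans h _; rewrite lerD2l; apply: le_trans (qs_le hp _ _) _.
by apply: ler_sum => j _; rewrite /rcoef coefB rmorphB.
Qed.

(** The upper bound takes [q] itself in the infimum; the lower bound holds because [p l] is
    1-Lipschitz, so every competitor is at least [p l q - wdist l a (rcoef q)]. *)
Lemma rnorm_lip l a q : `|rnorm l a - p l q| <= wdist l a (rcoef q).
Proof.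
have lb q' : p l q - wdist l a (rcoef q) <= p l q' + wdist l a (rcoef q').
  have := qnorm_lip l q q'; have := wdist_triangle l a (rcoef q) (rcoef q').
  rewrite (wdist_sym l (rcoef q) a); lra.
have hlb : has_lbound (range (fun q => p l q + wdist l a (rcoef q))).
  by exists (p l q - wdist l a (rcoef q)) => _ [q' _ <-].
rewrite ler_distlC; apply/andP; split.
  by rewrite lerBlDr; apply: (ge_inf hlb); exists q.
rewrite -lerBlDr; apply: lb_le_inf; first by exists (p l q + wdist l a (rcoef q)), q.
by move=> _ [q' _ <-]; have := lb q'; lra.
Qed.

(** Rational coefficients are dense for [wdist], so these bounds leave room for one number only.
    Identities for [rnorm] are proved by checking them. *)
Lemma rnorm_uniq l a t :
  (forall q, `|t - p l q| <= wdist l a (rcoef q)) -> t = rnorm l a.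
Proof.
move=> tP; apply/eqP; rewrite -subr_eq0 -normr_le0; apply/ler_addgt0Pr => e e0.
rewrite add0r; have [q qe] := wdist_dense l a (divr_gt0 e0 (ltr0n R 2)).
have := tP q; have := rnorm_lip l a q; have := ler_distD (p l q) t (rnorm l a).
by rewrite [`|p l q - _|]distrC; lra.
Qed.

Lemma rnorm_approx l a (e : R) : 0 < e ->
  exists q, wdist l a (rcoef q) < e /\ `|rnorm l a - p l q| < e.
Proof.
move=> /(wdist_dense l a)[q qe]; exists q; split => //.
exact: le_lt_trans (rnorm_lip l a q) qe.
Qed.

Lemma rnorm_cont l a b : `|rnorm l a - rnorm l b| <= wdist l a b.
Proof.
apply/ler_addgt0Pr => e e0.
have [q' [qa' qe']] := rnorm_approx l a (divr_gt0 e0 (ltr0n R 4)).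
have := rnorm_lip l b q'; have := wdist_triangle l a b (rcoef q').
have := wdist_triangle l b a (rcoef q').
rewrite (wdist_sym l b a); move: qe' qa'.
have := ler_distD (p l q') (rnorm l a) (rnorm l b).
by rewrite [`|p l q' - _|]distrC; lra.
Qed.

Lemma rnorm_ge0 l a : 0 <= rnorm l a.
Proof.
apply/ler_addgt0Pr => e /(rnorm_approx l a)[q [_]].
by rewrite ltr_distl => /andP[]; have := qs_ge0 hp l q; lra.
Qed.

Lemma rnormS l a : a l = 0 -> rnorm l.+1 a = rnorm l a.
Proof.
move=> al; apply: rnorm_uniq => q; rewrite -(qs_take hp).
apply: le_trans (rnorm_lip _ _ _) _; rewrite [wdist _ _ _]big_ord_recr/=.
rewrite al /rcoef coef_take_poly ltnn rmorph0 subrr normr0 mul0r addr0.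
by apply: ler_sum => j _; rewrite coef_take_poly ltn_ord.
Qed.

Lemma rnorm_stable k a : (forall j, (k <= j)%N -> a j = 0) ->
  forall l, (k <= l)%N -> rnorm l a = rnorm k a.
Proof.
move=> ak l /subnK <-; elim: (l - k)%N => [|i IHi]; first by rewrite add0n.
by rewrite addSn rnormS// ak// leq_addl.
Qed.

Lemma rnormD l a b : rnorm l (fun j => a j + b j) <= rnorm l a + rnorm l b.
Proof.
apply/ler_addgt0Pr => e e0.
have [q [qa qe]] := rnorm_approx l a (divr_gt0 e0 (ltr0n R 4)).
have [q' [qa' qe']] := rnorm_approx l b (divr_gt0 e0 (ltr0n R 4)).
have H : wdist l (fun j => a j + b j) (rcoef (q + q')) <=
    wdist l a (rcoef q) + wdist l b (rcoef q').
  rewrite -big_split; apply: ler_sum => j _ /=.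
  rewrite -mulrDl ler_wpM2r//; first exact: qs_N.
  by rewrite /rcoef coefD rmorphD/= opprD addrACA ler_normD.
have := qs_D hp l q q'; have := rnorm_lip l (fun j => a j + b j) (q + q').
move: qe qe'; rewrite !ltr_distl !ler_distl => /andP[? ?] /andP[? ?] /andP[? ?].
lra.
Qed.

Lemma rnormZ_rat l (r : rat) a :
  rnorm l (fun j => ratr r * a j) = `|ratr r| * rnorm l a.
Proof.
apply: esym; apply: rnorm_uniq => q.
have [->|r0] := eqVneq r 0.
  rewrite rmorph0 normr0 mul0r sub0r normrN ger0_norm ?(qs_ge0 hp)//.
  apply: le_trans (qs_le hp _ _) _; apply: ler_sum => j _.
  by rewrite mul0r sub0r normrN.
have -> : q = r *: (r^-1 *: q) by rewrite scalerA divff// scale1r.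
set q' := r^-1 *: q; rewrite (qs_Z hp) -mulrBr normrM normr_id.
have -> : wdist l (fun j => ratr r * a j) (rcoef (r *: q')) =
    `|ratr r| * wdist l a (rcoef q').
  rewrite mulr_sumr; apply: eq_bigr => j _.
  by rewrite /rcoef coefZ rmorphM/= -mulrBr normrM mulrA.
by rewrite ler_wpM2l// rnorm_lip.
Qed.

(** Homogeneity for rational scalars extends to real ones by continuity. *)
Lemma rnormZ l (t : R) a : rnorm l (fun j => t * a j) = `|t| * rnorm l a.
Proof.
(* Sum of the Lipschitz constants in [t] of the two sides, plus 1 for positivity. *)
pose C := 1 + wdist l a (fun=> 0) + rnorm l a.
have C0 : 0 < C by rewrite ltr_wpDr ?rnorm_ge0// ltr_wpDr ?wdist_ge0.
apply/eqP; rewrite -subr_eq0 -normr_le0; apply/ler_addgt0Pr => e e0.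
rewrite add0r; have [r re] := @ratr_dense R t (e / C) (divr_gt0 e0 C0).
have H1 : `|rnorm l (fun j => t * a j) - rnorm l (fun j => ratr r * a j)| <=
    `|t - ratr r| * wdist l a (fun=> 0).
  apply: le_trans (rnorm_cont _ _ _) _; rewrite mulr_sumr; apply: ler_sum => j _.
  by rewrite -mulrBl normrM subr0 mulrA.
have H2 : `| `|ratr r| * rnorm l a - `|t| * rnorm l a| <= `|t - ratr r| * rnorm l a.
  rewrite -mulrBl normrM (ger0_norm (rnorm_ge0 _ _)) ler_wpM2r ?rnorm_ge0//.
  by rewrite [leRHS]distrC; exact: ler_dist_dist.
have H3 := ler_distD (rnorm l (fun j => ratr r * a j))
  (rnorm l (fun j => t * a j)) (`|t| * rnorm l a).
rewrite rnormZ_rat in H1 H3.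
have H4 : `|t - ratr r| * C <= e by rewrite -ler_pdivlMr// ltW.
rewrite /C !mulrDr mulr1 in H4.
have := normr_ge0 (t - ratr r); lra.
Qed.

(** A nonzero last coefficient could be scaled to 1; rational approximants with last coefficient
    exactly 1 would then have arbitrarily small seminorm, against independence. Hence it vanishes,
    and induction handles the others. *)
Lemma rnorm_definite l a :
  (forall j, (j < l)%N -> exists2 e, 0 < e & forall q, q`_j = 1 -> e <= p j.+1 q) ->
  rnorm l a = 0 -> forall j, (j < l)%N -> a j = 0.
Proof.
elim: l => // l IHl indep a0.
have al : a l = 0.
  apply: contrapT => /eqP al; have [e e0 He] := indep l (ltnSn l).
  have b0 : rnorm l.+1 (fun j => (a l)^-1 * a j) = 0 by rewrite rnormZ a0 mulr0.
  have [q qe] := wdist_dense l (fun j => (a l)^-1 * a j) e0.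
  (* Resetting the coefficient of index [l] to 1 makes independence applicable and cancels the last
     term of the distance. *)
  pose q' : {poly rat} := take_poly l q + 'X^l.
  have ql : q'`_l = 1 by rewrite coefD coef_take_poly ltnn coefXn eqxx add0r.
  have qj j : (j < l)%N -> q'`_j = q`_j.
    by move=> jl; rewrite coefD coef_take_poly jl coefXn ltn_eqF// addr0.
  have := rnorm_lip l.+1 (fun j => (a l)^-1 * a j) q'.
  rewrite b0 sub0r normrN [wdist _ _ _]big_ord_recr/= /rcoef ql mulVf// rmorph1.
  rewrite subrr normr0 mul0r addr0 => /(le_trans (ler_norm _)).
  rewrite (_ : (\sum_(_ < _) _) = wdist l (fun j => (a l)^-1 * a j) (rcoef q)).
    by have := He _ ql; lra.
  by apply: eq_bigr => j _; rewrite qj.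
move=> j; rewrite ltnS leq_eqVlt => /orP[/eqP ->//|].
apply: IHl; last by rewrite -rnormS.
by move=> i il; apply: indep; exact: ltnW.
Qed.

End seminorm_extension.

(** * The bundle *)

Section coordinates.
Variable R : realType.

Definition vcoord n : Vspace R n -> nat -> R :=
  match n with
  | Some k => fun v => Defs.coord v
  | None => fun v => c00_val v
  end.

Lemma vcoord_linear n i : linear (fun v : Vspace R n => vcoord v i : R^o).
Proof. by case: n => [k|] a u v; [exact: coord_linear|]. Qed.

Lemma vcoordD n (u v : Vspace R n) i : vcoord (u + v) i = vcoord u i + vcoord v i.
Proof. by have := vcoord_linear i 1 u v; rewrite !scale1r. Qed.

Lemma vcoord0 n i : vcoord (0 : Vspace R n) i = 0.
Proof. by apply: (@addrI _ (vcoord (0 : Vspace R n) i)); rewrite -vcoordD !addr0. Qed.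

Lemma vcoordZ n (a : R) (u : Vspace R n) i : vcoord (a *: u) i = a * vcoord u i.
Proof. by have := vcoord_linear i a u 0; rewrite vcoord0 !addr0. Qed.

Lemma vcoord_support n (v : Vspace R n) :
  exists k, dim_le k n /\ forall i, (k <= i)%N -> vcoord v i = 0.
Proof.
case: n v => [k|] v /=.
  by exists k; split => // i ki; rewrite /Defs.coord insubN// -leqNgt.
by have /asboolP[k vk] := c00P v; exists k.
Qed.

Lemma vcoord_inj n (v : Vspace R n) : (forall i, vcoord v i = 0) -> v = 0.
Proof.
case: n v => [k|] v /= v0; last by apply: val_inj; apply/funext => i; exact: v0.
by apply/rowP => j; rewrite -coordP v0 mxE.
Qed.

Lemma vcoord_emb k n (v : 'rV[R]_k) : dim_le k n -> vcoord (emb n v) = Defs.coord v.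
Proof.
case: n => [m|] //= km; apply/funext => i; rewrite /Defs.coord.
case: insubP => [j _ <-|]; first by rewrite mxE.
rewrite -leqNgt => mi; case: insubP => // j jk _.
by rewrite ltnNge (leq_trans km mi) in jk.
Qed.

Lemma vcoord_le n (v : Vspace R n) i : `|vcoord v i| <= `|v|.
Proof. by case: n v => [k|] v; [exact: coord_le|exact: ler_c00_norm]. Qed.

Lemma vcoord_continuous n i : continuous (fun v : Vspace R n => vcoord v i).
Proof.
apply: (@short_linear_continuous R (Vspace R n) R^o).
  exact: vcoord_linear.
by move=> v; exact: vcoord_le.
Qed.

Lemma vcoord_measurable n i :
  measurable_fun setT (fun v : borel (Vspace R n) => vcoord v i).
Proof.
apply: (measurability (@RGenOInfty.G R)); first exact: RGenOInfty.measurableE.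
move=> _ [_ [x ->] <-]; rewrite setTI; apply: sub_sigma_algebra.
move/continuousP : (@vcoord_continuous n i); apply; exact: rray_open.
Qed.

End coordinates.

Section measurable_rnorm.
Context d (T : measurableType d) (R : realType).
Variables (p : nat -> {poly rat} -> T -> R) (N : nat -> T -> R) (a : T -> nat -> R).
Hypothesis mp : forall l q, measurable_fun setT (p l q).
Hypothesis mN : forall j, measurable_fun setT (N j).
Hypothesis ma : forall j, measurable_fun setT (a^~ j).
Hypothesis hp : forall x, qseminorm (fun l q => p l q x) (N^~ x).

Lemma measurable_rnorm l :
  measurable_fun setT (fun x => rnorm (fun l q => p l q x) (N^~ x) l (a x)).
Proof.
(* The infimum is enumerated by integers; those encoding no polynomial repeat the value at 0 and
   leave it unchanged. *)
pose F i x := let q := odflt 0 (unpickle i) in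
  p l q x + wdist (N^~ x) l (a x) (rcoef R q).
rewrite (_ : (fun x => _) = fun x => infs (F^~ x) 0).
  apply: measurable_fun_infs.
    move=> x _; exists 0 => _ [i _ <-].
    by rewrite addr_ge0//; [exact: (qs_ge0 (hp x))|exact: (wdist_ge0 (hp x))].
  move=> i; apply: measurable_funD => //.
  apply: measurable_sum => j; apply: measurable_funM => //.
  apply: measurableT_comp => //; apply: measurable_funB => //.
apply/funext => x; rewrite /rnorm /infs; congr inf; apply/seteqP; split.
  by move=> _ [q _ <-]; exists (pickle q) => //; rewrite /F pickleK.
by move=> _ [i _ <-]; exists (odflt 0 (unpickle i)).
Qed.

End measurable_rnorm.

(** * Fibre norms from the selected basis *)

Section basis_bundle.
Context d (X : measurableType d) (R : realType).
Variables (m : {measure set X -> \bar R}) (M : premodule m) (v : nat -> M).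

Definition pqnorm (x : X) (l : nat) (q : {poly rat}) : R := pnorm (qcomb v l q) x.

Definition pweight (x : X) (j : nat) : R := pnorm (v j) x.

Lemma ae_qseminorm : \forall x \ae m, qseminorm (pqnorm x) (pweight x).
Proof.
have h1 : \forall x \ae m, forall j, 0 <= pweight x j.
  by apply: ae_foralln => j; exact: pnorm_ge0.
have h2 : \forall x \ae m, forall i : nat * {poly rat}, 0 <= pqnorm x i.1 i.2.
  by apply: ae_forall_count => i; exact: pnorm_ge0.
have h3 : \forall x \ae m, forall i : nat * {poly rat} * {poly rat},
    pqnorm x i.1.1 (i.1.2 + i.2) <= pqnorm x i.1.1 i.1.2 + pqnorm x i.1.1 i.2.
  by apply: ae_forall_count => i; rewrite /pqnorm qcombD; exact: ler_pnormD.
have h4 : \forall x \ae m, forall i : nat * rat * {poly rat},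
    pqnorm x i.1.1 (i.1.2 *: i.2) = `|ratr i.1.2| * pqnorm x i.1.1 i.2.
  apply: ae_forall_count => i; rewrite /pqnorm qcombZ.
  apply: filterS2 (pnormZE (L0_cst m (ratr i.1.2)) (qcomb v i.1.1 i.2))
    (L0_cstE m (ratr i.1.2)) => x -> -> //.
have h5 : \forall x \ae m, forall i : nat * {poly rat},
    pqnorm x i.1 i.2 <= \sum_(j < i.1) `|ratr i.2`_j| * pweight x j.
  apply: ae_forall_count => i.
  have H : \forall x \ae m, forall j, L0_cst m (ratr i.2`_j) x = ratr i.2`_j.
    by apply: ae_foralln => j; exact: L0_cstE.
  apply: filterS2 H (pnorm_lcomb v i.1 (fun j => L0_cst m (ratr i.2`_j))) => x H.
  by under eq_bigr do rewrite H.
apply: filterS3 (filterI h1 h2) h3 (filterI h4 h5) => x [{}h1 {}h2] {}h3 [{}h4 {}h5].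
split => //.
- by move=> l q; exact: (h2 (l, q)).
- by move=> l q q'; exact: (h3 (l, q, q')).
- by move=> l r q; exact: (h4 (l, r, q)).
- by move=> l q; exact: (h5 (l, q)).
- by move=> l q; rewrite /pqnorm qcomb_take.
Qed.

(** The link between module and fibres: by [rnorm_uniq] only rational combinations need comparing,
    and the difference from one of them is again a combination, bounded by the triangle
    inequality. *)
Lemma pnorm_lcomb_rnorm k (f : nat -> L0 m) : \forall x \ae m,
  pnorm (lcomb v k f) x = rnorm (pqnorm x) (pweight x) k (fun j => f j x).
Proof.
have H1 : \forall x \ae m, forall q,
    `|pnorm (lcomb v k f) x - pqnorm x k q| <= pnorm (lcomb v k f - qcomb v k q) x.
  by apply: ae_forall_count => q; exact: pnorm_dist.
have H2 : \forall x \ae m, forall q, pnorm (lcomb v k f - qcomb v k q) x <=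
    \sum_(j < k) `|(f j - L0_cst m (ratr q`_j) : L0 m) x| * pweight x j.
  by apply: ae_forall_count => q; rewrite /qcomb lcombB; exact: pnorm_lcomb.
have H3 : \forall x \ae m, forall i : {poly rat} * nat,
    (f i.2 - L0_cst m (ratr i.1`_i.2) : L0 m) x = f i.2 x - ratr i.1`_i.2.
  apply: ae_forall_count => -[q j] /=.
  apply: filterS3 (L0_DE (f j) (- L0_cst m (ratr q`_j)))
    (L0_NE (L0_cst m (ratr q`_j))) (L0_cstE m (ratr q`_j)) => x -> -> -> //.
apply: filterS3 ae_qseminorm H1 (filterI H2 H3) => x hp {}H1 [{}H2 {}H3].
apply: rnorm_uniq hp _ _ _ _ => q; apply: le_trans (H1 q) _; apply: le_trans (H2 q) _.
by apply: ler_sum => j _; rewrite (H3 (q, j : nat)).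
Qed.

(** Positive distance at [x] from [v j] to the rational span of its predecessors, in the form used
    by [rnorm_definite]. *)
Definition pindep (j : nat) (x : X) :=
  exists2 e : R, 0 < e & forall q : {poly rat}, q`_j = 1 -> e <= pqnorm x j.+1 q.

Lemma not_in_qspan_pindep j x : ~ in_qspan v j (v j) x -> pindep j x.
Proof.
move=> /existsNP[n /forallNP H]; exists n.+1%:R^-1; first by rewrite invr_gt0.
move=> q qj; rewrite leNgt; apply/negP => Hq; apply: (H (- q)).
rewrite [X in pnorm X](_ : _ = qcomb v j.+1 q)// qcombS qj rmorph1 L0_cst1 scale1r.
by rewrite qcombN opprK addrC.
Qed.

Variables (Z : set X) (mZ : measurable Z).
Hypothesis hZ : forall x, ~ Z x -> qseminorm (pqnorm x) (pweight x).

(** Zero data on [Z] make the seminorm axioms hold at every point. *)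
Let bq l q := (fun x => pqnorm x l q) \_ (~` Z).
Let bw j := (fun x => pweight x j) \_ (~` Z).

Let bqs x : qseminorm (fun l q => bq l q x) (bw^~ x).
Proof.
have [Zx|Zx] := pselect (Z x).
  rewrite (_ : (fun l q => bq l q x) = (fun=> fun=> 0)); last first.
    by apply/funext => l; apply/funext => q; rewrite /bq patchE memNset//=; exact.
  rewrite (_ : bw^~ x = fun=> 0); last first.
    by apply/funext => j; rewrite /bw patchE memNset//=; exact.
  split => //= *; rewrite ?addr0 ?mulr0//.
  by apply: sumr_ge0 => j _; rewrite mulr0.
rewrite (_ : (fun l q => bq l q x) = pqnorm x); last first.
  by apply/funext => l; apply/funext => q; rewrite /bq patchE mem_set.
rewrite (_ : bw^~ x = pweight x); first exact: hZ.
by apply/funext => j; rewrite /bw patchE mem_set.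
Qed.

(** The sequence is eventually constant, coordinates being finitely supported. A limit treats all
    dimensions alike and gives joint measurability without choosing the length of the support. *)
Definition basis_norm n (x : X) (a : Vspace R n) : R :=
  limn (fun l => rnorm (fun l q => bq l q x) (bw^~ x) l (vcoord a)).

Lemma basis_norm_cvg n x (a : Vspace R n) k :
  (forall i, (k <= i)%N -> vcoord a i = 0) ->
  rnorm (fun l q => bq l q x) (bw^~ x) l (vcoord a) @[l --> \oo] -->
  rnorm (fun l q => bq l q x) (bw^~ x) k (vcoord a).
Proof.
move=> ak; apply: cvg_near_cst; exists k => // l /= kl.
exact: (rnorm_stable (bqs x)).
Qed.

Lemma basis_normE n x (a : Vspace R n) k :
  (forall i, (k <= i)%N -> vcoord a i = 0) ->
  basis_norm x a = rnorm (fun l q => bq l q x) (bw^~ x) k (vcoord a).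
Proof. by move=> ak; apply: cvg_lim => //; exact: basis_norm_cvg. Qed.

Lemma basis_norm_out n x (a : Vspace R n) k : ~ Z x ->
  (forall i, (k <= i)%N -> vcoord a i = 0) ->
  basis_norm x a = rnorm (pqnorm x) (pweight x) k (vcoord a).
Proof.
move=> Zx /basis_normE ->; congr rnorm.
  by apply/funext => l; apply/funext => q; rewrite /bq patchE mem_set.
by apply/funext => j; rewrite /bw patchE mem_set.
Qed.

Lemma basis_norm_measurable n (A : set X) (mA : measurable A) :
  measurable_fun (A `*` [set: borel (Vspace R n)])
    (fun p : X * borel (Vspace R n) => basis_norm p.1 p.2).
Proof.
apply: measurable_funTS.
apply: (@measurable_fun_cvg _ _ _ _ (fun l (p : X * borel (Vspace R n)) =>
  rnorm (fun l q => bq l q p.1) (bw^~ p.1) l (vcoord p.2))) => //; last first.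
  move=> [x a] _ /=; have [k [_ ak]] := vcoord_support a.
  by rewrite (basis_normE x ak); exact: basis_norm_cvg.
have mpatch (f : X -> R) : measurable_fun setT f ->
    measurable_fun setT (fun p : X * borel (Vspace R n) => (f \_ (~` Z)) p.1).
  move=> mf; apply: measurableT_comp => //.
  apply/(measurable_restrictT _ (measurableC mZ)); exact: measurable_funTS.
move=> l; apply: (@measurable_rnorm _ _ _ (fun l q (p : X * borel (Vspace R n)) => bq l q p.1)
  (fun j p => bw j p.1) (fun p => @vcoord R n p.2) _ _ _ _ l).
- by move=> l' q; apply: mpatch; exact: measurable_pnorm.
- by move=> j; apply: mpatch; exact: measurable_pnorm.
- by move=> j; apply: (measurableT_comp (@vcoord_measurable R n j)).
- by move=> p; exact: bqs.
Qed.

Section bundle.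
Variables (n : option nat) (A : set X) (mA : measurable A).
Hypothesis indepA : forall x, A x -> forall j, dim_le j.+1 n -> ~ Z x /\ pindep j x.

Lemma basis_norm_norm x : A x -> is_norm (@basis_norm n x).
Proof.
move=> Ax; split.
- move=> a; have [k [_ ak]] := vcoord_support a.
  by rewrite (basis_normE x ak); exact: (rnorm_ge0 (bqs x)).
- move=> a; have [k [kn ak]] := vcoord_support a.
  rewrite (basis_normE x ak) => a0; apply: vcoord_inj => i.
  have [ik|/ak//] := ltnP i k.
  apply: (rnorm_definite (bqs x) _ a0) ik => j jk.
  have [Zx [e e0 He]] : ~ Z x /\ pindep j x.
    by apply: indepA => //; case: n kn {a ak a0} => //= n'; exact: leq_trans.
  by exists e => // q qj; rewrite /bq patchE mem_set//; exact: He.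
- move=> a b; have [k [_ ak]] := vcoord_support a; have [l [_ bl]] := vcoord_support b.
  have ak' i : (maxn k l <= i)%N -> vcoord a i = 0.
    by rewrite geq_max => /andP[/ak].
  have bl' i : (maxn k l <= i)%N -> vcoord b i = 0.
    by rewrite geq_max => /andP[_ /bl].
  rewrite (basis_normE x ak') (basis_normE x bl') (@basis_normE _ _ _ (maxn k l)).
    apply: le_trans (rnormD (bqs x) _ _ _).
    rewrite le_eqVlt; apply/orP; left; apply/eqP; congr rnorm.
    by apply/funext => i; rewrite vcoordD.
  by move=> i i1; rewrite vcoordD ak'// bl'// addr0.
- move=> t a; have [k [_ ak]] := vcoord_support a.
  rewrite (basis_normE x ak) -(rnormZ (bqs x)) (@basis_normE _ _ _ k).
    by congr rnorm; apply/funext => i; rewrite vcoordZ.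
  by move=> i ki; rewrite vcoordZ ak// mulr0.
Qed.

Definition basis_bundle : banach_bundle R A n :=
  BanachBundle (@basis_norm_measurable n A mA) basis_norm_norm.

End bundle.

End basis_bundle.

Lemma dim_le0 n : dim_le 0 n. Proof. by case: n. Qed.

(** * Components of finite-dimensional sections *)

Section section_components.
Context d (X : measurableType d) (R : realType) (mu : {measure set X -> \bar R}).

Definition component k (s : vsections mu k) (l : nat) : L0 mu :=
  ae_class mu (measurableT_comp (@vcoord_measurable R (Some k) l) (ae_class_measurable s)).

Lemma componentE k (s : vsections mu k) l :
  \forall x \ae mu, component s l x = Defs.coord (s x) l.
Proof. exact: ae_class_repr. Qed.

Lemma component_linear k (a : L0 mu) (s t : vsections mu k) l :
  component (a *: s + t) l = a * component s l + component t l.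
Proof.
apply: L0P; apply: filterS3 (componentE (a *: s + t) l)
  (filterI (componentE s l) (componentE t l))
  (filterI (filterI (L0_DE (a * component s l) (component t l)) (L0_ME a (component s l)))
    (filterI (vsectionsDE (a *: s) t) (vsectionsZE a s))).
move=> x -> [st tt] [[-> ->] [-> ->]].
by rewrite st tt -/(GRing.scale (a x : R) _) coord_linear.
Qed.

Lemma component_emb j k (s : vsections mu j) l : (j <= k)%N ->
  component (vsections_emb k s) l = component s l.
Proof.
move=> jk; apply: L0P; have H : \forall x \ae mu, vsections_emb k s x = emb (Some k) (s x).
  exact: (ae_class_repr mu (measurableT_comp (@emb_measurable R (Some k) j)
    (ae_class_measurable s))).
apply: filterS3 (componentE (vsections_emb k s) l) (componentE s l) H => x -> -> ->.
exact: (congr1 (@^~ l) (@vcoord_emb R j (Some k) (s x) jk)).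
Qed.

Lemma component_out k (s : vsections mu k) l : (k <= l)%N -> component s l = 0.
Proof.
move=> kl; apply: L0P; apply: filterS2 (componentE s l) (L0_0E mu) => x -> ->.
by rewrite /Defs.coord insubN// -leqNgt.
Qed.

Definition qsection k (q : {poly rat}) : vsections mu k :=
  ae_class mu (measurable_cst (\row_(l < k) ratr q`_l : borel 'rV[R]_k)).

Lemma component_qsection k q l : (l < k)%N ->
  component (qsection k q) l = L0_cst mu (ratr q`_l).
Proof.
move=> lk; apply: L0P.
have H : \forall x \ae mu, qsection k q x = \row_(l < k) ratr q`_l.
  exact: (ae_class_repr mu (measurable_cst (\row_(l < k) ratr q`_l : borel 'rV[R]_k))).
apply: filterS3 (componentE (qsection k q) l) (L0_cstE mu (ratr q`_l)) H => x -> -> ->.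
by rewrite -[l]/(val (Ordinal lk)) coordP mxE.
Qed.

End section_components.

(** * Sections of the bundle *)

Section section_limit.
Context d (X : measurableType d) (R : realType).
Variables (m : {measure set X -> \bar R}) (M : normed_module m) (v : nat -> M).
Variables (Z : set X) (mZ : measurable Z).
Hypothesis hZ : forall x, ~ Z x -> qseminorm (pqnorm v x) (pweight v x).
Hypothesis Z0 : \forall x \ae m, ~ Z x.
Hypothesis adm : admissible m.
Variables (n : option nat) (A : set X) (mA : measurable A).
Hypothesis indepA : forall x, A x -> forall j, dim_le j.+1 n -> ~ Z x /\ pindep v j x.
Local Notation mu := (mrestr m mA).
Hypothesis admA : admissible mu.
Variable w : nat -> M.
Hypothesis wdense : forall u : M, \forall x \ae m, forall e, 0 < e ->
  exists i, pnorm (u - w i) x < e.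
Hypothesis wspan : \forall x \ae m, A x -> forall i, exists2 k,
  dim_le k n & in_qspan v k (w i) x.

Local Notation E := (basis_bundle mZ hZ mA indepA).
Local Notation MA := (rest_module mA adm M).

Let comb k (s : vsections mu k) : M := lcomb v k (fun l => L0_ext (component s l)).

Let comb_rest k (s : vsections mu k) : comb s \in @rest_pred _ _ _ m A mA M.
Proof.
rewrite unfold_in /comb /lcomb scaler_sumr; apply/eqP; apply: eq_bigr => j _.
by rewrite scalerA -L0_extM mul1r.
Qed.

Definition section_map (k : dims_below n) (s : trunc_sections m mA E k) : MA :=
  Rest (comb_rest s).

Let section_map_linear k : linear (@section_map k).
Proof.
move=> a s t; apply: val_inj; rewrite /= /comb /lcomb scaler_sumr -big_split/=.
apply: eq_bigr => j _.
by rewrite component_linear L0_extD L0_extM scalerDl scalerA.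
Qed.

(** The fibre norm was built for this isometry: on [A] and off [Z], both sides are the value of
    [rnorm] at the coordinates of [s x]. *)
Let section_map_norm k (s : vsections mu (val k)) :
  pnorm (@section_map k s) = pnorm (s : trunc_sections m mA E k).
Proof.
apply: L0P; apply/ae_mrestr.
have H1 := rest_normE (@section_map k s : rest mA M).
have /(ae_mrestr m mA) H2 := fsec_normE (sub_bundle mA E (valP k)) s.
have H3 := pnorm_lcomb_rnorm v (val k) (fun l => L0_ext (component s l)).
have H4 : \forall x \ae m, forall l, A x -> L0_ext (component s l) x = Defs.coord (s x) l.
  apply: ae_foralln => l; have /(ae_mrestr m mA) H := componentE s l.
  by apply: filterS2 H (L0_ext_in (component s l)) => x H Hin Ax; rewrite Hin// H.
apply: filterS3 (filterI H1 H2) (filterI H3 H4) Z0 => x [{}H1 {}H2] [{}H3 {}H4] Zx Ax.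
rewrite [LHS]H1// [RHS]H2// [LHS]H3 /= /sub_bnorm /=.
have sk : forall i, (val k <= i)%N -> vcoord (emb n (s x)) i = 0.
  move=> i ki; rewrite vcoord_emb; last exact: valP k.
  by rewrite /Defs.coord insubN// -leqNgt.
rewrite (basis_norm_out hZ Zx sk) vcoord_emb; last exact: valP k.
by congr rnorm; apply/funext => l; exact: H4.
Qed.

Let section_map_iota (j k : dims_below n) (jk : (val j <= val k)%N)
    (s : trunc_sections m mA E j) :
  section_map (Defs.iota jk s) = @section_map j s.
Proof.
apply: val_inj; rewrite /= /comb /lcomb.
rewrite (big_ord_widen _ (fun l => L0_ext (component s l) *: v l) jk).
rewrite [RHS]big_mkcond; apply: eq_bigr => l _ /=.
rewrite component_emb//; case: ltnP => // jl; rewrite component_out//.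
have -> : L0_ext (0 : L0 mu) = 0; last by rewrite scale0r.
by apply: (@addrI _ (L0_ext (0 : L0 mu))); rewrite -L0_extD !addr0.
Qed.

Let k0 : dims_below n := exist _ 0%N (dim_le0 n).

(** An enumeration of all lengths and rational coefficients, since [dense_extension] expects a
    sequence; spare integers give length 0. *)
Let index i : dims_below n * {poly rat} := odflt (k0, 0) (unpickle i).

Let qsec i : trunc_sections m mA E (index i).1 := qsection mu (val (index i).1) (index i).2.

(** On [A], [u] is close to some [w j], which is close to a rational combination of the basis, and
    this agrees on [A] with the image of a constant rational section. *)
Let qsec_dense (u : MA) : \forall x \ae mu, forall e, 0 < e ->
  exists i, pnorm (u - section_map (qsec i)) x < e.
Proof.
apply/ae_mrestr.
have H1 : \forall x \ae m, forall i, A x ->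
    rest_norm (u - section_map (qsec i) : rest mA M) x =
    pnorm (rest_val (u : rest mA M) - comb (qsec i)) x.
  by apply: ae_foralln => i; exact: rest_normE.
have H2 : \forall x \ae m, forall i, A x ->
    pnorm (comb (qsec i) - qcomb v (val (index i).1) (index i).2) x = 0.
  apply: ae_foralln => i; rewrite /comb /qcomb lcombB; set f : nat -> L0 m := fun j : nat => _ - _.
  have Hf : \forall x \ae m, forall j, A x -> (j < val (index i).1)%N -> (f j : L0 m) x = 0.
    apply: ae_foralln => j; have [jk|_] := ltnP j (val (index i).1); last exact: aeW.
    rewrite /f component_qsection//; set r := ratr _.
    have /(ae_mrestr m mA) H := L0_cstE mu r.
    apply: filterS3 (filterI H (L0_ext_in (L0_cst mu r)))
      (L0_DE (L0_ext (L0_cst mu r)) (- L0_cst m r))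
      (filterI (L0_NE (L0_cst m r)) (L0_cstE m r)).
    by move=> x [Hr Hin] -> [-> ->] Ax _; rewrite Hin// Hr// subrr.
  apply: filterS3 Hf (pnorm_lcomb v (val (index i).1) f)
    (pnorm_ge0 (lcomb v (val (index i).1) f)) => x {}Hf Hle Hge Ax.
  apply/eqP; rewrite eq_le Hge andbT; apply: le_trans Hle _.
  by rewrite big1// => j _; rewrite Hf// normr0 mul0r.
have H3 : \forall x \ae m, forall ij : nat * nat,
    let q := qcomb v (val (index ij.1).1) (index ij.1).2 in
    pnorm (rest_val (u : rest mA M) - comb (qsec ij.1)) x <=
    pnorm (rest_val (u : rest mA M) - w ij.2) x +
    (pnorm (w ij.2 - q) x + pnorm (comb (qsec ij.1) - q) x).
  apply: ae_forall_count => -[i j] /=; set q := qcomb _ _ _.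
  rewrite [pnorm (comb _ - _)]pnormB_sym.
  apply: filterS2 (pnorm_triangle (w j) (rest_val (u : rest mA M)) (comb (qsec i)))
    (pnorm_triangle q (w j) (comb (qsec i))) => x; lra.
apply: filterS3 (filterI H1 H2) (filterI H3 wspan) (wdense (rest_val (u : rest mA M))).
move=> x [{}H1 {}H2] [{}H3 spanx] densex Ax e e0.
have e20 : 0 < e / 2 by rewrite divr_gt0.
have [j uj] := densex _ e20; have [k kn /in_qspan_eps span_j] := spanx Ax j.
have [q wq] := span_j _ e20.
pose i := pickle ((exist _ k kn : dims_below n), q).
have iE : index i = ((exist _ k kn : dims_below n), q) by rewrite /index pickleK.
have {}wq : pnorm (w j - qcomb v (val (index i).1) (index i).2) x < e / 2.
  by rewrite iE.
exists i; rewrite [ltLHS]H1//; have := H3 (i, j); rewrite /= H2// addr0 => H.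
by apply: le_lt_trans H _; rewrite [ltRHS]splitr ltrD.
Qed.

(** The maps are isometric with jointly dense image. The union [Rel] of the graphs of the test
    cocone is therefore linear and contractive, and its unique extension by density is the universal
    morphism. *)
Lemma section_map_limit : is_section_module section_map.
Proof.
split.
- move=> k; split; first exact: section_map_linear.
  by move=> s; rewrite section_map_norm; exact: aeW.
- exact: section_map_iota.
move=> N h hmor hcompat.
pose Rel (u : MA) (y : N) := exists k s, u = @section_map k s /\ y = h k s.
have Rlin a u y u' y' : Rel u y -> Rel u' y' -> Rel (a *: u + u') (a *: y + y').
  move=> [k [s [-> ->]]] [k' [s' [-> ->]]].
  (* Two sections are added after padding the shorter to the larger dimension. *)
  have [kk'|/ltnW k'k] := leqP (val k) (val k').
    exists k', (a *: (Defs.iota kk' s : trunc_sections m mA E k') + s'); split.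
      by rewrite section_map_linear section_map_iota.
    by rewrite (hmor k').1 hcompat.
  exists k, (a *: s + (Defs.iota k'k s' : trunc_sections m mA E k)); split.
    by rewrite section_map_linear section_map_iota.
  by rewrite (hmor k).1 hcompat.
have Rle u y : Rel u y -> \forall x \ae mu, pnorm y x <= pnorm u x.
  by move=> [k [s [-> ->]]]; rewrite section_map_norm; exact: (hmor k).2.
have tR i : Rel (section_map (qsec i), h _ (qsec i)).1 (section_map (qsec i), h _ (qsec i)).2.
  by exists (index i).1, (qsec i).
have [Phi [[Phi_mor PhiR] Phi_uniq]] := dense_extension admA Rlin Rle tR qsec_dense.
exists Phi; split; first by split => // k s; apply: PhiR; exists k, s.
move=> Psi [Psi_mor PsiR]; apply: Phi_uniq; split => // u y [k [s [-> ->]]].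
exact: PsiR.
Qed.

End section_limit.

Lemma isomorphic_of_isometry d (X : measurableType d) (R : realType)
    (mu : {measure set X -> \bar R}) (M N : premodule mu) (Psi : M -> N) :
  linear Psi -> (forall u, pnorm (Psi u) = pnorm u) ->
  (forall s, exists u, Psi u = s) -> isomorphic N M.
Proof.
move=> Plin Pnorm /choice[Phi PhiK].
have PsiK : cancel Psi Phi.
  move=> u; apply/eqP; rewrite -subr_eq0; apply/eqP/pnorm_eq0.
  rewrite -Pnorm addrC -scaleN1r Plin PhiK scaleN1r addNr.
  exact/pnorm_eq0.
exists Phi; split; last by move=> s; rewrite -Pnorm PhiK.
  by move=> a s t; rewrite -[RHS]PsiK Plin !PhiK.
by exists Psi.
Qed.

(** * Recovering the module from its restrictions *)

Section gluing_restrictions.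
Context d (X : measurableType d) (R : realType).
Variables (m : {measure set X -> \bar R}) (M : normed_module m).
Hypothesis adm : admissible m.
Variable E : separable_bundle X R.
Variable c : forall n (k : dims_below n),
  trunc_sections m (sb_measurable E n) (sb_bundle E n) k ->
  rest_module (sb_measurable E n) adm M.
Hypothesis climit : forall n, is_section_module (@c n).
Local Notation G := (@SectionSpaces _ _ _ m E
  (fun n => rest_module (sb_measurable E n) adm M) c climit).
Local Notation chi n := (L0_ext (1 : L0 (mrestr m (sb_measurable E n)))).

Let restriction (u : M) : Gamma G :=
  fun n => Rest (rest_ext (1 : L0 (mrestr m (sb_measurable E n))) u).

Let restriction_linear : linear restriction.
Proof.
move=> a u u'; apply: functional_extensionality_dep => n; apply: val_inj => /=.
rewrite scalerDr; congr (_ + _).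
by rewrite L0_ext_res !scalerA mulrAC -L0_extM mulr1.
Qed.

Let restriction_norm u : pnorm (restriction u) = pnorm u.
Proof.
apply: L0P; apply: (@ae_cover _ _ _ m E) => n.
have H1 := @Gamma_normE _ _ _ _ _ G (restriction u) n.
have H2 := @ext_normE _ _ _ m _ _ (rest_premodule (sb_measurable E n) M)
  (restriction u n).
have H3 := @rest_normE _ _ _ m _ (sb_measurable E n) M (restriction u n).
have H4 := pnormZE (chi n) u.
have H5 := @L0_ext1E _ _ _ m _ (sb_measurable E n).
apply: filterS3 (filterI H1 H2) (filterI H3 H4) H5.
move=> x [{}H1 {}H2] [{}H3 {}H4] {}H5 Ax.
rewrite [LHS]H1// [LHS]H2 patchE mem_set// [LHS]H3// [LHS]H4 H5 indicE mem_set//.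
by rewrite normr1 mul1r.
Qed.

(** The preimage is glued from the components of [s], using at each point the one whose base set
    contains it. *)
Let restriction_surj (s : Gamma G) : exists u, restriction u = s.
Proof.
have /choice[k kP] := Gamma_in E.
have kE n : [set x | k x = n] = sb_base E n.
  apply/seteqP; split => x /=; first by move=> <-.
  by move=> Anx; apply: (@sb_trivIset _ _ _ E _ _ I I); exists x.
have [|u uP] := @countable_glue _ _ _ _ adm M _
  (fun n => rest_val (s n : rest (sb_measurable E n) M)) k.
  by move=> n; rewrite kE; exact: sb_measurable.
exists u; apply: functional_extensionality_dep => n; apply: val_inj => /=.
set t : rest (sb_measurable E n) M := s n.
apply: pnorm_ae_eq; rewrite -[in X in _ - X](rest_chi t) -scalerBr.
have H := @L0_ext1E _ _ _ m _ (sb_measurable E n).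
apply: filterS3 uP (pnormZE (chi n) (u - rest_val t)) H => x ux -> ->.
have [Ax|Ax] := pselect (sb_base E n x); rewrite indicE.
  have kx : k x = n by move: Ax; rewrite -kE.
  by rewrite -kx in t *; rewrite /t ux mulr0.
by rewrite memNset// normr0 mul0r.
Qed.

Lemma Gamma_restrictions : isomorphic (Gamma G) M.
Proof.
exact: isomorphic_of_isometry restriction_linear restriction_norm restriction_surj.
Qed.

End gluing_restrictions.

(** * Construction of the bundle from the selected basis *)

Theorem theoremA6 (d : measure_display) (X : measurableType d) (R : realType)
    (m : {sigma_finite_measure set X -> \bar R})
    (hX : forall x : X, measurable [set x])
    (M : normed_module m) (hM : separable_module M) :
  exists (E : separable_bundle X R) (G : section_spaces m E),
    isomorphic (Gamma G) M.
Proof.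
have sfm := sigma_finiteT m.
have adm : admissible m := admissible_sigma_finite sfm.
have [w wdense] := separable_ae_dense adm hM.
have [S [v [mS Sv]]] := pointwise_basis adm w.
have [Z [mZ mZ0 HZ]] := filterI Sv (ae_qseminorm v).
have good x : ~ Z x -> (forall l, [/\ S l x -> ~ in_qspan v l (v l) x,
    ~ S l x -> forall i, in_qspan v l (w i) x &
    forall i, (i < l)%N -> in_qspan v l (w i) x]) /\
    qseminorm (pqnorm v x) (pweight v x).
  by move=> Zx; apply: contrapT => nx; exact/Zx/HZ.
have hZ x : ~ Z x -> qseminorm (pqnorm v x) (pweight v x) by move=> /good[].
have Z0 : \forall x \ae m, ~ Z x by exists Z; split => // x /contrapT.
(* Counting [Z] in the stopping event gives its points dimension 0, where independence demands
   nothing. *)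
have [|dimx [mdim dS dN]] := @first_index _ X (fun k x => Z x \/ ~ S k x).
  by move=> k; apply: measurableU => //; exact/measurable_not/mS.
have indep n x : dimx x = n -> forall j, dim_le j.+1 n -> ~ Z x /\ pindep v j x.
  move=> xn j jn; have nC : ~ (Z x \/ ~ S j x).
    by case: n xn jn => [k|] xn jn; [have [_] := dS _ _ xn; exact|exact: dN].
  have Zx : ~ Z x by move=> Zx; apply: nC; left.
  split => //; apply: not_in_qspan_pindep; have [/(_ j)[h _ _] _] := good _ Zx.
  by apply: h; apply: contrapT => nS; apply: nC; right.
have wspan n : \forall x \ae m, dimx x = n -> forall i, exists2 k,
    dim_le k n & in_qspan v k (w i) x.
  apply: filterS Z0 => x Zx xn i; have [g _] := good _ Zx.
  (* In infinite dimension [w i] lies in the closed span of the first [i.+1] vectors; in dimension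
     [k] the selection has stopped, and [k] vectors suffice for every [w i]. *)
  case: n xn => [k|] xn; last by exists i.+1 => //; have [_ _] := g i.+1; exact.
  exists k => //=; have [_ h _] := g k; apply: h.
  by have [[//|]] := dS _ _ xn.
have triv : trivIset setT (fun n => [set x | dimx x = n]).
  by apply/trivIsetP => i j _ _ ij; apply/seteqP; split => x //= [-> /eqP]; rewrite (negbTE ij).
have cover : \bigcup_n [set x | dimx x = n] = setT.
  by apply/seteqP; split => // x _; exists (dimx x).
pose E := SeparableBundle mdim triv cover
  (fun n => basis_bundle mZ hZ (mdim n) (@indep n)).
have admA n := admissible_sigma_finite (sigma_finite_mrestr (mdim n) sfm).
exists E, (@SectionSpaces _ _ _ m E (fun n => rest_module (mdim n) adm M) _
  (fun n => @section_map_limit _ _ _ m M v Z mZ hZ Z0 adm n _ (mdim n) (@indep n)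
    (admA n) w wdense (wspan n))).
exact: Gamma_restrictions.
Qed.
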